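(* Let $B$ be a standard one-dimensional Brownian motion. If $f\colon[0,1]\to\mathbb{R}$ is a $1/2$-Hölder continuous function such that $f(0)=0$, then the Hausdorff dimension of $\mathcal{Z}(B-f)=\{t\in(0,1]:B(t)=f(t)\}$ is equal to $1/2$, almost surely.
   Context: $B=(B(t))_{t\ge 0}$ starts at $0$. For a real function $g$ on a subset of $[0,\infty)$, $\mathcal{Z}(g)$ denotes the set of zeros of $g$ in $(0,\infty)$ (within its domain). *)

(* Defs.v *)
From HB Require Import structures.
From mathcomp Require Import all_boot all_order all_algebra.
From mathcomp Require Import all_classical all_reals all_analysis.

Set Implicit Arguments.
Unset Strict Implicit.
Unset Printing Implicit Defensive.

Import Order.TTheory GRing.Theory Num.Theory.
Import numFieldNormedType.Exports.

Local Open Scope classical_set_scope.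
Local Open Scope ring_scope.

Section hausdorff_dimension.
Context {R : realType}.
Implicit Types (A E : set R) (s delta : R).

(* Equal to -oo on set0, which therefore meets every bound diam E <= delta. *)
Definition diam E : \bar R :=
  ereal_sup [set `|x - y|%:E | x in E & y in E].

(* The convention diam(set0)^s = 0 for all s >= 0 lets finite coverings be
   padded with set0; nonempty sets of diameter 0 have weight 0 ^ 0 = 1 for
   s = 0, so that the case s = 0 gives the counting measure. *)
Definition diam_pow s E : \bar R :=
  if E == set0 then 0%E else (diam E `^ s)%E.

Definition is_delta_cover delta A (E : nat -> set R) : Prop :=
  A `<=` \bigcup_i E i /\ forall i, (diam (E i) <= delta%:E)%E.

Definition hausdorff_premeasure s delta A : \bar R :=
  ereal_inf [set (\sum_(0 <= i <oo) diam_pow s (E i))%E |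
              E in is_delta_cover delta A].

Definition hausdorff_measure s A : \bar R :=
  ereal_sup [set hausdorff_premeasure s delta A | delta in [set d | 0 < d]].

Definition hausdorff_dim A : \bar R :=
  ereal_inf [set s%:E | s in [set s | 0 <= s /\ hausdorff_measure s A = 0%E]].

End hausdorff_dimension.

Definition hoelder_continuous_on {R : realType} (a : R) (D : set R)
    (f : R -> R) : Prop :=
  exists C : R, forall s t, D s -> D t -> `|f s - f t| <= C * `|s - t| `^ a.

(* Zeros in (0, +oo) of a function with domain D. *)
Definition zeros {R : realType} (D : set R) (g : R -> R) : set R :=
  [set t | [/\ D t, 0 < t & g t = 0]].

Section brownian_motion.
Context {R : realType} {d : measure_display} {T : measurableType d}.
Variable P : probability T R.

Definition mutually_independent (I : finType) (X : I -> T -> R) : Prop :=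
  forall (J : {set I}) (A : I -> set R), (forall i, measurable (A i)) ->
    P (\bigcap_(i in [set` J]) (X i @^-1` A i)) =
    (\prod_(i in J) P (X i @^-1` A i))%E.

(* The process is indexed by [0, +oo): values at negative times are
   unconstrained. The second parameter of normal_prob is the standard
   deviation. A finite family of times t 0 <= ... <= t n is given as the
   beginning of a nondecreasing sequence. *)
Record standard_brownian_motion (B : R -> T -> R) : Prop := {
  bm_measurable : forall t : R, 0 <= t -> measurable_fun setT (B t) ;
  bm_start : {ae P, forall w, B 0 w = 0} ;
  bm_independent_increments : forall (n : nat) (t : nat -> R),
    0 <= t 0%N -> (forall i, t i <= t i.+1) ->
    mutually_independent (fun (i : 'I_n) w => B (t i.+1) w - B (t i) w) ;
  bm_gaussian_increments : forall s t : R, 0 <= s -> s < t ->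
    forall A : set R, measurable A ->
      P ((fun w => B t w - B s w) @^-1` A) =
      normal_prob 0 (Num.sqrt (t - s)) A ;
  bm_continuous :
    {ae P, forall w, {within `[0, +oo[, continuous (fun t => B t w)}}
}.

End brownian_motion.

(* Main.v *)
(* Let W be B recentred at its initial value and g = W - f, |f t| <= C sqrt t.

   Upper bound. Fix s > 1/2. By Borel-Cantelli the dyadic increments of W at
   level j are eventually all at most b^j, for any b > 2^(-1/2), so a zero of g
   in a dyadic cell of level n forces |g| <= Q b^n at its right endpoint.
   The expected number of such cells is at most 4 Q (2 b)^n, and b can be chosen
   with 2 b 2^(-s) < 1: by Markov's inequality the s-sums of these coverings
   tend to 0 along a subsequence.

   Lower bound. Fix s < 1/2. On each of K scales t ~ theta^(2 k), k < K, put a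
   mass 1 / (N p) at each of N times of a regular grid where |g| is below a
   window comparable to the square root of the mesh, p being the probability of
   that event.  The expected mass is K; for small theta distinct scales are
   almost uncorrelated, and this replaces a zero-one law: the mass
   exceeds K / 2 with probability close to 1.  The s-energy of the mass has a
   bounded expectation, and a path for which mass and energy are controlled for
   infinitely many N has a zero set of positive s-dimensional measure, by
   compactness and the Cauchy-Schwarz inequality. *)

Require Import Defs.
From HB Require Import structures.
From mathcomp Require Import all_boot all_order all_algebra.
From mathcomp Require Import ring lra.
From mathcomp Require Import all_classical all_reals all_analysis.
From mathcomp Require Import measurable_realfun.

Import Order.TTheory GRing.Theory Num.Theory.
Import numFieldNormedType.Exports.

Set Implicit Arguments.
Unset Strict Implicit.
Unset Printing Implicit Defensive.

Local Open Scope classical_set_scope.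
Local Open Scope ring_scope.

(** A 1/2-Hoelder boundary need not lie in the Cameron-Martin space, so the law of [W - f] need not
    be comparable with that of [W]: every estimate is made directly on the gaussian law of one
    increment, or of two independent ones. The exponent 1/2 is what makes this work: |f t| <= C sqrt
    t keeps the boundary within C standard deviations of [W t], so a window of half-width r is hit
    at time t with probability between two multiples of r / sqrt t. These two multiples differ, and
    therefore the weights divide by the exact probability p: each scale then has mean mass exactly
    one, and only the ratios P(A and A') / (P(A) P(A')) remain to be bounded. Between distinct
    scales the ratio must be close to 1, which forces sharp gaussian estimates; within a scale a
    constant is enough, up to the singularity (t - s)^(-1/2), which can be summed against |t -
    s|^(-s) exactly when s < 1/2. All events are built from finitely many times and are measurable;
    the exceptional sets of paths are only shown to be contained in null sets. *)

(** * Fatou, Markov and Chebyshev for finite combinations of indicators *)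

Section probability_tools.
Context {R : realType} {d : measure_display} {T : measurableType d}.
Variable P : probability T R.

(* Fatou for sets: P (liminf A_n) <= liminf P (A_n). *)
Lemma negligible_liminf (N : set T) :
  (forall eta : R, 0 < eta -> exists A : nat -> set T,
     [/\ forall n, measurable (A n),
       exists n0, forall n, (n0 <= n)%N -> (P (A n) <= eta%:E)%E &
       forall w, N w -> exists n0, forall n, (n0 <= n)%N -> A n w]) ->
  P.-negligible N.
Proof.
move=> H.
have [A HA] : {A : nat -> nat -> set T & forall k,
    [/\ forall n, measurable (A k n),
      exists n0, forall n, (n0 <= n)%N -> (P (A k n) <= (k.+1%:R^-1)%:E)%E &
      forall w, N w -> exists n0, forall n, (n0 <= n)%N -> A k n w]}.
  apply: (@choice _ _ (fun k A => [/\ forall n, measurable (A n),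
      exists n0, forall n, (n0 <= n)%N -> (P (A n) <= (k.+1%:R^-1)%:E)%E &
      forall w, N w -> exists n0, forall n, (n0 <= n)%N -> A n w])) => k.
  by apply: H; rewrite invr_gt0.
pose F k m := \bigcap_n A k (m + n)%N.
pose L k := \bigcup_m F k m.
have mF k m : measurable (F k m).
  by apply: bigcap_measurable => // n _; case: (HA k).
have mL k : measurable (L k) by apply: bigcup_measurable.
have PL k : (P (L k) <= (k.+1%:R^-1)%:E)%E.
  have [mA [n0 Pn0] _] := HA k.
  have ndF : nondecreasing_seq (F k).
    move=> m m' mm'; apply/subsetPset => w Fw n _.
    by rewrite -(subnKC mm') -addnA; apply: Fw.
  have cvP := @nondecreasing_cvg_mu _ _ _ P _ (mF k) (mL k) ndF.
  rewrite -(cvg_lim _ cvP)//; apply: lime_le; first by apply/cvg_ex; exists (P (L k)).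
  near=> m; apply: le_trans (Pn0 (m + n0)%N (leq_addl _ _)).
  apply: le_measure; rewrite ?inE//.
  by move=> w; apply.
exists (\bigcap_k L k); split.
- by apply: bigcap_measurable.
- apply/eqP; rewrite eq_le measure_ge0 andbT.
  apply/lee_addgt0Pr => e e0; rewrite add0e.
  have [k ke] : exists k : nat, k.+1%:R^-1 < e.
    exists (Num.trunc e^-1); rewrite invf_plt ?posrE//.
    by rewrite truncnS_gt.
  apply: (@le_trans _ _ (P (L k))); last first.
    by apply: le_trans (PL k) _; rewrite lee_fin ltW.
  apply: le_measure; rewrite ?inE//; first by apply: bigcap_measurable.
  by move=> w; apply.
- move=> w Nw k _; have [_ _ /(_ w Nw) [m Hm]] := HA k.
  by exists m => // n _; apply: Hm; rewrite leq_addr.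
Unshelve. all: by end_near.
Qed.

Definition Pr (A : set T) : R := fine (P A).

Lemma PrE (A : set T) : measurable A -> P A = (Pr A)%:E.
Proof. by move=> mA; rewrite /Pr fineK// fin_num_measure. Qed.

Lemma Pr_ge0 (A : set T) : 0 <= Pr A.
Proof. exact: fine_ge0. Qed.

Lemma measurable_simple_ge (I : finType) (c : I -> R) (A : I -> set T) (x : R) :
  (forall i, measurable (A i)) ->
  measurable [set w | x <= \sum_i c i * \1_(A i) w].
Proof.
move=> mA.
have mY : measurable_fun setT (fun w => \sum_i c i * \1_(A i) w).
  apply: measurable_sum => i; apply: measurable_funM => //.
have := mY measurableT `[x, +oo[%classic (measurable_itv _).
rewrite setTI; congr (measurable _).
by apply/seteqP; split => w /=; rewrite in_itv/= andbT.
Qed.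

(** Masses, energies and counts are all finite combinations of indicators, so integrals are confined
    to this proof. Only the sum has to be nonnegative: [chebyshev_simple] applies it with negative
    coefficients. *)
Lemma markov_simple (I : finType) (c : I -> R) (A : I -> set T) (x : R) :
  (forall i, measurable (A i)) -> 0 < x ->
  (forall w, 0 <= \sum_i c i * \1_(A i) w) ->
  (P [set w | (x <= \sum_i c i * \1_(A i) w)%R] <=
   ((\sum_i c i * Pr (A i)) / x)%:E)%E.
Proof.
move=> mA x0 Y0.
set S := [set w | _].
have mS : measurable S by apply: measurable_simple_ge.
rewrite PrE// lee_fin ler_pdivlMr// mulrC -lee_fin.
have iA (C : set T) : measurable C -> P.-integrable setT (EFin \o \1_C).
  by move=> mC; apply: integrable_indic => //; rewrite ltey_eq fin_num_measure.
have iZ (C : set T) (k : R) : measurable C ->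
    P.-integrable setT (fun w => (k * \1_C w)%:E).
  by move=> mC; exact: (integrableZl measurableT k (iA C mC)).
have intZ (C : set T) (k : R) : measurable C ->
    (\int[P]_w (k * \1_C w)%:E)%E = (k * Pr C)%:E.
  move=> mC; under eq_integral do rewrite EFinM.
  rewrite (integralZl measurableT (iA C mC)) integral_indic//= setIT EFinM.
  by rewrite PrE.
have iY : P.-integrable setT (fun w => (\sum_i c i * \1_(A i) w)%R%:E).
  under eq_fun do rewrite -sumEFin.
  by apply: integrable_sum => // i _; exact: iZ.
have -> : (\sum_i c i * Pr (A i))%:E =
    (\int[P]_w (\sum_i c i * \1_(A i) w)%R%:E)%E.
  under [RHS]eq_integral do rewrite -sumEFin.
  rewrite integral_sum//=; last by move=> i; exact: iZ.
  by rewrite -sumEFin; apply: eq_bigr => i _; rewrite intZ.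
rewrite -intZ//.
apply: le_integral => //; first exact: iZ.
move=> w _; rewrite lee_fin.
rewrite indicE; case: (boolP (w \in S)) => [|_]; last by rewrite mulr0.
by rewrite inE mulr1.
Qed.

(** The expanded square is again a combination of indicators, because a product of indicators is the
    indicator of an intersection. *)
Lemma chebyshev_simple (I : finType) (u : I -> R) (A : I -> set T) (m x : R) :
  (forall i, measurable (A i)) -> 0 < x ->
  measurable [set w | x <= (m - \sum_i u i * \1_(A i) w) ^+ 2] /\
  (P [set w | (x <= (m - \sum_i u i * \1_(A i) w) ^+ 2)%R] <=
   ((\sum_i \sum_j u i * u j * Pr (A i `&` A j) -
     2 * m * (\sum_i u i * Pr (A i)) + m ^+ 2) / x)%:E)%E.
Proof.
move=> mA x0.
(* [J] indexes the monomials of the square: products of two terms, cross terms with [m], and the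
   constant. *)
pose J : finType := ((I * I) + (I + unit))%type.
pose c (z : J) : R := match z with
  | inl (i, j) => u i * u j | inr (inl i) => - (2 * m * u i)
  | inr (inr _) => m ^+ 2 end.
pose C (z : J) : set T := match z with
  | inl (i, j) => A i `&` A j | inr (inl i) => A i | inr (inr _) => setT end.
have mC z : measurable (C z).
  by case: z => [[i j]|[i|[]]] //=; exact: measurableI.
have sumE (G : set T -> R) : \sum_z c z * G (C z) =
    \sum_i \sum_j u i * u j * G (A i `&` A j) -
    2 * m * (\sum_i u i * G (A i)) + m ^+ 2 * G setT.
  rewrite big_sumType/= big_sumType/= -addrA; congr (_ + (_ + _)).
  - by rewrite pair_bigA/=; apply: eq_bigr => -[].
  - rewrite mulr_sumr -sumrN; apply: eq_bigr => i _; ring.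
  - by rewrite (big_pred1 tt)// => -[].
have E w : (m - \sum_i u i * \1_(A i) w) ^+ 2 = \sum_z c z * \1_(C z) w.
  rewrite (sumE (fun X => \1_X w)).
  have -> : \sum_i \sum_j u i * u j * \1_(A i `&` A j) w =
      (\sum_i u i * \1_(A i) w) * (\sum_i u i * \1_(A i) w) :> R.
    rewrite mulr_suml; apply: eq_bigr => i _; rewrite mulr_sumr.
    by apply: eq_bigr => j _; rewrite indicI/=; ring.
  by rewrite indicT/=; ring.
have -> : [set w | x <= (m - \sum_i u i * \1_(A i) w) ^+ 2] =
    [set w | x <= \sum_z c z * \1_(C z) w].
  by apply/seteqP; split => w /=; rewrite E.
split; first exact: measurable_simple_ge.
apply: le_trans (markov_simple mC x0 _) _.
  by move=> w; rewrite -E sqr_ge0.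
by rewrite (sumE Pr) /(Pr setT) probability_setT mulr1.
Qed.

End probability_tools.

(** * Gaussian probabilities of windows and tails *)

Section gaussian_bounds.
Context {R : realType}.
Implicit Types v c r y D : R.
Local Notation mu := (@lebesgue_measure R).

(** Parametrised by the variance, which for an increment is t - s. *)
Definition gauss_density v y := (Num.sqrt (2 * pi * v))^-1 * expR (- (y ^+ 2 / (2 * v))).

Lemma normal_pdf_gauss_density v y : 0 < v ->
  normal_pdf 0 (Num.sqrt v) y = gauss_density v y.
Proof.
move=> v0; rewrite normal_pdfE ?gt_eqF ?sqrtr_gt0//.
rewrite /gauss_density /normal_peak /normal_fun sqr_sqrtr ?ltW// subr0.
by congr ((Num.sqrt _)^-1 * expR _); rewrite ?mulNr -mulr_natl; ring.
Qed.

Lemma gauss_density_ge0 v y : 0 <= gauss_density v y.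
Proof. by rewrite mulr_ge0 ?expR_ge0// invr_ge0 sqrtr_ge0. Qed.

Lemma measurable_ball_itv c r : measurable [set y : R | `|y - c| <= r].
Proof.
have -> : [set y : R | `|y - c| <= r] = `[c - r, c + r]%classic.
  by apply/seteqP; split => y /=; rewrite in_itv/= ler_distl.
exact: measurable_itv.
Qed.

Let mu_ball c r : 0 <= r -> mu [set y : R | `|y - c| <= r] = (2 * r)%:E.
Proof.
move=> r0.
have -> : [set y : R | `|y - c| <= r] = `[c - r, c + r]%classic.
  by apply/seteqP; split => y /=; rewrite in_itv/= ler_distl.
rewrite lebesgue_measure_itv/= lte_fin.
case: ltP => [_|].
  by rewrite -EFinD; congr EFin; ring.
by move=> h; congr EFin; lra.
Qed.

Let integral_ball_cst c r D : 0 <= r ->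
  (\int[mu]_(y in [set y : R | (`|y - c| <= r)%R]) D%:E = (2 * r * D)%:E)%E.
Proof.
move=> r0; rewrite integral_cst//; last exact: measurable_ball_itv.
by rewrite mulrC EFinM; congr (_ * _)%E; exact: mu_ball.
Qed.

Let mpdf v : measurable_fun setT (EFin \o (normal_pdf 0 (Num.sqrt v) : R -> R)).
Proof. by apply/measurable_EFinP; exact: measurable_normal_pdf. Qed.

Lemma normal_ball_le v c r D : 0 < v -> 0 <= r ->
  (forall y, `|y - c| <= r -> gauss_density v y <= D) ->
  (normal_prob 0 (Num.sqrt v) [set y : R | (`|y - c| <= r)%R] <= (2 * r * D)%:E)%E.
Proof.
move=> v0 r0 HD; rewrite /normal_prob.
have mI := measurable_ball_itv c r.
have D0 : 0 <= D.
  by apply: le_trans (gauss_density_ge0 v c) (HD c _); rewrite subrr normr0.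
apply: (@le_trans _ _ (\int[mu]_(y in [set y : R | (`|y - c| <= r)%R]) D%:E)%E).
  apply: ge0_le_integral => //.
  - by move=> y _; rewrite lee_fin normal_pdf_ge0.
  - by apply: measurable_funTS; exact: mpdf.
  - by move=> y Iy; rewrite lee_fin normal_pdf_gauss_density// HD.
by rewrite integral_ball_cst.
Qed.

Lemma normal_ball_ge v c r D : 0 < v -> 0 <= r -> 0 <= D ->
  (forall y, `|y - c| <= r -> D <= gauss_density v y) ->
  ((2 * r * D)%:E <= normal_prob 0 (Num.sqrt v) [set y : R | (`|y - c| <= r)%R])%E.
Proof.
move=> v0 r0 D0 HD; rewrite /normal_prob.
have mI := measurable_ball_itv c r.
apply: (@le_trans _ _ (\int[mu]_(y in [set y : R | (`|y - c| <= r)%R]) D%:E)%E).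
  by rewrite integral_ball_cst.
apply: ge0_le_integral => //.
- by apply: measurable_funTS; exact: mpdf.
- by move=> y Iy; rewrite lee_fin normal_pdf_gauss_density// HD.
Qed.

Lemma measurable_norm_gt r : measurable [set y : R | r < `|y|].
Proof.
have mn : measurable_fun setT (fun y : R => `|y|) by apply: measurableT_comp.
have := mn measurableT `]r, +oo[%classic (measurable_itv _).
rewrite setTI; congr (measurable _).
by apply/seteqP; split => w /=; rewrite in_itv/= andbT.
Qed.

(* On |y| > r, half of the exponent of the density is spent on the bound and
   the other half is the density of variance 2 v. *)
Lemma normal_tail v r : 0 < v -> 0 <= r ->
  (normal_prob 0 (Num.sqrt v) [set y : R | (r < `|y|)%R] <=
   (2 * expR (- (r ^+ 2 / (4 * v))))%:E)%E.
Proof.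
move=> v0 r0; rewrite /normal_prob.
have mI := measurable_norm_gt r.
set E := 2 * _.
have E0 : 0 <= E by rewrite mulr_ge0 ?expR_ge0.
apply: (@le_trans _ _ (\int[mu]_(y in [set y : R | (r < `|y|)%R])
    (E%:E * (normal_pdf 0 (Num.sqrt (2 * v)) y)%:E))%E).
  apply: ge0_le_integral => //.
  - by move=> y _; rewrite lee_fin normal_pdf_ge0.
  - by apply: measurable_funTS; exact: mpdf.
  - apply: measurable_funTS; apply: emeasurable_funM => //.
    exact: mpdf.
  - move=> y /= ry; rewrite -EFinM lee_fin !normal_pdf_gauss_density ?mulr_gt0//.
    rewrite /gauss_density /E.
    have -> : 2 * pi * (2 * v) = 2 * (2 * pi * v) by ring.
    rewrite (sqrtrM (2 * pi * v)) // (invfM (Num.sqrt 2)).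
    (* Doubling the variance divides the peak by sqrt 2; the factor 2 in [E] pays for it. *)
    have h1 : 2 * (Num.sqrt 2)^-1 >= 1 :> R.
      rewrite ler_pdivlMr ?sqrtr_gt0// mul1r.
      have : Num.sqrt 2 ^+ 2 = 2 :> R by rewrite sqr_sqrtr.
      have : 0 <= Num.sqrt 2 :> R by rewrite sqrtr_ge0.
      by nra.
    have h2 : expR (- (y ^+ 2 / (2 * v))) <=
       expR (- (r ^+ 2 / (4 * v))) * expR (- (y ^+ 2 / (2 * (2 * v)))).
      rewrite -expRD ler_expR -opprD lerN2.
      have -> : 2 * (2 * v) = 4 * v by ring.
      rewrite -mulrDl ler_pdivrMr ?mulr_gt0//.
      have -> : y ^+ 2 / (2 * v) * (4 * v) = 2 * y ^+ 2.
        by field; rewrite gt_eqF.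
      have : r ^+ 2 <= y ^+ 2.
        by rewrite -[y ^+ 2]real_normK ?num_real// lerXn2r ?nnegrE// ltW.
      lra.
    have S0 : 0 <= (Num.sqrt (2 * pi * v))^-1 by rewrite invr_ge0 sqrtr_ge0.
    set S := (Num.sqrt (2 * pi * v))^-1 in S0 *.
        apply: (le_trans (ler_wpM2l S0 h2)).
    set X := expR _; set Y := expR _.
    have -> : 2 * X * ((Num.sqrt 2)^-1 * S * Y) =
       2 * (Num.sqrt 2)^-1 * (S * (X * Y)) by ring.
    rewrite ler_peMl//; apply: mulr_ge0 => //; apply: mulr_ge0; exact: expR_ge0.
apply: (@le_trans _ _ (\int[mu]_y
    (E%:E * (normal_pdf 0 (Num.sqrt (2 * v)) y)%:E))%E).
  apply: ge0_subset_integral => //.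
  - apply: emeasurable_funM => //; exact: mpdf.
  - by move=> y _; rewrite -EFinM lee_fin mulr_ge0// normal_pdf_ge0.
rewrite ge0_integralZl//.
- by rewrite integral_normal_pdf mule1.
- exact: mpdf.
- by move=> y _; rewrite lee_fin normal_pdf_ge0.
Qed.

End gaussian_bounds.

(** * From gaussian bounds to Brownian increments *)

Section brownian_estimates.
Context {R : realType} {d : measure_display} {T : measurableType d}.
Variables (P : probability T R) (B : R -> T -> R).
Hypothesis hB : standard_brownian_motion P B.
Implicit Types s t a b c r D : R.

Local Notation Pr := (Pr P).

(* Brownian motion recentred at its (almost surely null) initial value: its
   one-dimensional laws are exactly gaussian. *)
Definition recentre t (w : T) : R := B t w - B 0 w.
Local Notation W := recentre.

Definition near_event t c r : set T := [set w | `|W t w - c| <= r].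

Lemma measurable_increment s t : 0 <= s -> 0 <= t ->
  measurable_fun setT (fun w => B t w - B s w).
Proof.
by move=> s0 t0; apply: measurable_funB; apply: (bm_measurable hB).
Qed.

Lemma measurable_increment_ball s t c r : 0 <= s -> 0 <= t ->
  measurable [set w | `|B t w - B s w - c| <= r].
Proof.
move=> s0 t0; have := measurable_increment s0 t0 measurableT (measurable_ball_itv c r).
by rewrite setTI.
Qed.

Lemma measurable_near_event t c r : 0 <= t -> measurable (near_event t c r).
Proof. by move=> t0; apply: measurable_increment_ball. Qed.

Lemma measurable_increment_gt s t r : 0 <= s -> 0 <= t ->
  measurable [set w | r < `|B t w - B s w|].
Proof.
move=> s0 t0; have := measurable_increment s0 t0 measurableT (measurable_norm_gt r).
by rewrite setTI.
Qed.

Lemma increment_ball_le s t c r D : 0 <= s -> s < t -> 0 <= r ->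
  (forall y, `|y - c| <= r -> gauss_density (t - s) y <= D) ->
  Pr [set w | `|B t w - B s w - c| <= r] <= 2 * r * D.
Proof.
move=> s0 st r0 HD.
rewrite -lee_fin -PrE; last by apply: measurable_increment_ball => //; lra.
have /= -> := bm_gaussian_increments hB s0 st (measurable_ball_itv c r).
by apply: normal_ball_le => //; rewrite subr_gt0.
Qed.

Lemma increment_ball_ge s t c r D : 0 <= s -> s < t -> 0 <= r -> 0 <= D ->
  (forall y, `|y - c| <= r -> D <= gauss_density (t - s) y) ->
  2 * r * D <= Pr [set w | `|B t w - B s w - c| <= r].
Proof.
move=> s0 st r0 D0 HD.
rewrite -lee_fin -PrE; last by apply: measurable_increment_ball => //; lra.
have /= -> := bm_gaussian_increments hB s0 st (measurable_ball_itv c r).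
by apply: normal_ball_ge => //; rewrite subr_gt0.
Qed.

Lemma increment_tail s t r : 0 <= s -> s < t -> 0 <= r ->
  Pr [set w | r < `|B t w - B s w|] <= 2 * expR (- (r ^+ 2 / (4 * (t - s)))).
Proof.
move=> s0 st r0.
rewrite -lee_fin -PrE; last by apply: measurable_increment_gt => //; lra.
have /= -> := bm_gaussian_increments hB s0 st (measurable_norm_gt r).
by apply: normal_tail => //; rewrite subr_gt0.
Qed.

(** If both windows are hit, the increment from s to t is within r + r' of b - a, and it is
    independent of the first event. *)
Lemma near_event2_le s t a b r r' : 0 < s -> s < t ->
  Pr (near_event s a r `&` near_event t b r') <=
  Pr (near_event s a r) * Pr [set w | `|B t w - B s w - (b - a)| <= r + r'].
Proof.
move=> s0 st.
(* The times 0, s, t, t, ...: the default value of [nth] keeps the sequence nondecreasing beyond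
   index 2. *)
pose tau (i : nat) : R := nth t [:: 0; s] i.
pose A (i : 'I_2) : set R :=
  if i == ord0 then [set y | `|y - a| <= r] else [set y | `|y - (b - a)| <= r + r'].
have tau0 : 0 <= tau 0%N by [].
have taui i : tau i <= tau i.+1.
  by rewrite /tau; case: i => [|[|i]] /=; rewrite ?nth_nil ?lexx ?ltW.
have mA i : measurable (A i).
  by rewrite /A; case: ifP => _; exact: measurable_ball_itv.
have := @bm_independent_increments _ _ _ _ _ hB 2 tau tau0 taui [set: 'I_2]%SET A mA.
rewrite (eq_bigl xpredT) => [|i]; last by rewrite !inE.
rewrite !big_ord_recl big_ord0 mule1.
have -> : (fun w => B (tau (@ord0 1).+1) w - B (tau (@ord0 1)) w) @^-1` A ord0 =
    near_event s a r by [].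
have -> : (fun w => B (tau (lift ord0 (@ord0 0)).+1) w -
    B (tau (lift ord0 (@ord0 0))) w) @^-1` A (lift ord0 ord0) =
    [set w | `|B t w - B s w - (b - a)| <= r + r'] by [].
have mN := measurable_near_event a r (ltW s0).
have mN' : measurable (near_event t b r').
  by apply: measurable_near_event; lra.
have mI : measurable [set w | `|B t w - B s w - (b - a)| <= r + r'].
  by apply: measurable_increment_ball; lra.
move=> E; rewrite -lee_fin EFinM -!PrE//; last exact: measurableI.
rewrite -E; apply: le_measure; rewrite ?inE.
- exact: measurableI.
- apply: fin_bigcap_measurable => // i _.
  rewrite -[X in measurable X]setTI; apply: measurable_increment => //.
  + by rewrite /tau; case: i => [[|[|i]]] //= _; lra.
  + by rewrite /tau; case: i => [[|[|i]]] //= _; lra.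
- move=> w [/= Nw N'w] i _; rewrite /A /=.
  case: (eqVneq i ord0) => [->//|ne].
  have i1 : (i : nat) = 1%N.
    by case: i ne => [[|[|i]]].
  rewrite /tau i1/=.
  have -> : B t w - B s w - (b - a) = (W t w - b) - (W s w - a).
    by rewrite /recentre; ring.
  by apply: le_trans (ler_normB _ _) _; rewrite addrC; exact: lerD.
Qed.

End brownian_estimates.

(** * Hitting a window around a boundary of order sqrt t, at one time and at two times *)

Section boundary_estimates.
Context {R : realType} {d : measure_display} {T : measurableType d}.
Variables (P : probability T R) (B : R -> T -> R).
Hypothesis hB : standard_brownian_motion P B.
Implicit Types s t a b c r q C : R.

Local Notation Pr := (Pr P).
Local Notation near_event := (near_event B).

(** Uses pi >= 2. The constant 2 cancels against the length 2 r of a window, which thus has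
    probability at most r / sqrt v. *)
Lemma gauss_density_le v y : 0 < v -> gauss_density v y <= (2 * Num.sqrt v)^-1 :> R.
Proof.
move=> v0; rewrite /gauss_density.
apply: (@le_trans _ _ (Num.sqrt (2 * pi * v))^-1).
  rewrite ler_piMr// ?invr_ge0 ?sqrtr_ge0// -[leRHS]expR0 ler_expR oppr_le0.
  by rewrite divr_ge0 ?sqr_ge0// mulr_ge0// ltW.
have p2 := pi_ge2 R.
have -> : 2 * Num.sqrt v = Num.sqrt (2 ^+ 2 * v).
  by rewrite sqrtrM ?sqr_ge0// sqrtr_sqr ger0_norm.
by rewrite lef_pV2 ?posrE ?sqrtr_gt0 ?mulr_gt0 ?pi_gt0//; rewrite ler_wsqrtr//; nra.
Qed.

Lemma increment_ball_le_ratio s t c r : 0 <= s -> s < t -> 0 <= r ->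
  Pr [set w | `|B t w - B s w - c| <= r] <= r / Num.sqrt (t - s).
Proof.
move=> s0 st r0.
have ts : 0 < t - s by rewrite subr_gt0.
apply: le_trans (increment_ball_le hB s0 st r0 (fun y _ => gauss_density_le y ts)) _.
rewrite invfM mulrACA mulfV// mul1r//.
Qed.

Lemma near_event_le t c r : 0 < t -> 0 <= r ->
  Pr (near_event t c r) <= r / Num.sqrt t.
Proof.
by move=> t0 r0; have := increment_ball_le_ratio c (lexx 0) t0 r0; rewrite subr0.
Qed.

(** Across the window y^2 / (2 t) exceeds c^2 / (2 t) by at most (C + 1/2) q, rounded up to (C + 1)
    q. The loss tends to 1 with q, as the comparison of distant scales requires; the coarse bound
    [near_event_ge_ratio] is the case q = 1. *)
Lemma near_event_ge t c r q C : 0 < t -> 0 <= r -> 0 <= C -> 0 <= q <= 1 ->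
  `|c| <= C * Num.sqrt t -> r <= q * Num.sqrt t ->
  2 * r * (gauss_density t c * expR (- ((C + 1) * q))) <= Pr (near_event t c r).
Proof.
move=> t0 r0 C0 /andP[q0 q1] cC rq.
apply: (increment_ball_ge hB) => //.
  by rewrite mulr_ge0 ?gauss_density_ge0 ?expR_ge0.
move=> y yc; rewrite subr0 /gauss_density -mulrA -expRD.
rewrite ler_wpM2l ?invr_ge0 ?sqrtr_ge0// ler_expR -opprD lerN2.
rewrite ler_pdivrMr ?mulr_gt0// mulrDl divfK ?gt_eqF ?mulr_gt0//.
have St0 : 0 <= Num.sqrt t by rewrite sqrtr_ge0.
have Sq : t = Num.sqrt t ^+ 2 by rewrite sqr_sqrtr// ltW.
set S := Num.sqrt t in cC rq St0 Sq *.
have -> : y ^+ 2 = c ^+ 2 + 2 * (c * (y - c)) + (y - c) ^+ 2 by ring.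
have h1 : c * (y - c) <= C * S * (q * S).
  apply: le_trans (ler_norm _) _; rewrite normrM.
  by apply: ler_pM => //; apply: le_trans yc rq.
have h2 : (y - c) ^+ 2 <= (q * S) ^+ 2.
  rewrite -[leLHS]real_normK ?num_real// lerXn2r ?nnegrE ?mulr_ge0//.
  exact: le_trans yc rq.
have h3 : (q * S) ^+ 2 <= q * S ^+ 2.
  by rewrite exprMn expr2 ler_wpM2r ?sqr_ge0// ler_piMl.
rewrite Sq.
have := sqr_ge0 S; nra.
Qed.

(** C^2 bounds the exponent c^2 / (2 t), C + 1 is the loss of [near_event_ge] at q = 1, and 1/2
    comes from 2 / sqrt (2 pi) >= 2 / 4. *)
Definition near_const C : R := expR (- (C ^+ 2 + C + 1)) / 2.

Lemma near_const_gt0 C : 0 < near_const C.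
Proof. by rewrite divr_gt0 ?expR_gt0. Qed.

Lemma near_event_ge_ratio t c r C : 0 < t -> 0 <= r -> 0 <= C ->
  `|c| <= C * Num.sqrt t -> r <= Num.sqrt t ->
  near_const C * (r / Num.sqrt t) <= Pr (near_event t c r).
Proof.
move=> t0 r0 C0 cC rS.
have S0 : 0 < Num.sqrt t by rewrite sqrtr_gt0.
have Sq : Num.sqrt t ^+ 2 = t by rewrite sqr_sqrtr// ltW.
apply: le_trans (@near_event_ge t c r 1 C t0 r0 C0 _ cC _); rewrite ?ler01 ?lexx ?mul1r//.
rewrite /gauss_density /near_const mulr1.
have p4 : pi <= 4 :> R by have := pihalf_lt2 R; lra.
have h1 : (4 * Num.sqrt t)^-1 <= (Num.sqrt (2 * pi * t))^-1.
  have -> : 4 * Num.sqrt t = Num.sqrt (4 ^+ 2 * t).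
    by rewrite sqrtrM ?sqr_ge0// sqrtr_sqr ger0_norm.
  have := pi_gt0 R => pi0.
  by rewrite lef_pV2 ?posrE ?sqrtr_gt0 ?mulr_gt0 ?exprn_gt0//; rewrite ler_wsqrtr//; nra.
have h2 : expR (- (C ^+ 2 + C + 1)) <=
    expR (- (c ^+ 2 / (2 * t))) * expR (- (C + 1)).
  rewrite -expRD ler_expR -opprD lerN2 addrA !lerD2r.
  rewrite ler_pdivrMr ?mulr_gt0//.
  have : c ^+ 2 <= (C * Num.sqrt t) ^+ 2.
    by rewrite -[leLHS]real_normK ?num_real// lerXn2r ?nnegrE ?mulr_ge0// ltW.
  rewrite exprMn Sq; have := sqr_ge0 C; nra.
have -> : expR (- (C ^+ 2 + C + 1)) / 2 * (r / Num.sqrt t) =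
   2 * r * ((4 * Num.sqrt t)^-1 * expR (- (C ^+ 2 + C + 1))).
  by field; rewrite gt_eqF.
apply: ler_wpM2l; first by rewrite mulr_ge0.
rewrite -mulrA; apply: ler_pM => //; rewrite ?expR_ge0// invr_ge0 mulr_ge0// ltW//.
Qed.

(* The exponent C^2 + 3 C + 4 collects the error terms of the three ratios: the
   window lengths, the variances t and t - s, and the gaussian exponents. *)
Lemma near_event2_far s t a b r r' q C : 0 < s -> s < t -> 0 <= q <= 1 / 2 ->
  0 <= C -> s <= q ^+ 2 * t -> `|a| <= C * Num.sqrt s -> `|b| <= C * Num.sqrt t ->
  0 <= r -> 0 <= r' -> r <= q * r' -> r' <= q * Num.sqrt t ->
  Pr (near_event s a r `&` near_event t b r') <=
  Pr (near_event s a r) * Pr (near_event t b r') *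
  expR ((C ^+ 2 + 3 * C + 4) * q).
Proof.
move=> s0 st /andP[q0 q1] C0 sq aC bC r0 r'0 rr' r'S.
have t0 : 0 < t by lra.
have S0 : 0 < Num.sqrt t by rewrite sqrtr_gt0.
have Sq : Num.sqrt t ^+ 2 = t by rewrite sqr_sqrtr// ltW.
have sS : Num.sqrt s <= q * Num.sqrt t.
  rewrite -[q]ger0_norm// -sqrtr_sqr -sqrtrM ?sqr_ge0//.
  exact: ler_wsqrtr.
apply: le_trans (near_event2_le hB a b r r' s0 st) _.
rewrite -[leRHS]mulrA; apply: ler_wpM2l; first exact: Pr_ge0.
have q01 : 0 <= q <= 1 by rewrite q0/=; lra.
have low := near_event_ge t0 r'0 C0 q01 bC r'S.
apply: le_trans (ler_wpM2r (expR_ge0 _) low).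
pose D := gauss_density t b * expR ((C ^+ 2 + 2 * C + 2 )* q).
have q_lt1 : 0 < 1 - q by lra.
have up : Pr [set w | `|B t w - B s w - (b - a)| <= r + r'] <= 2 * (r + r') * D.
  apply: (increment_ball_le hB) => //; [exact: ltW|exact: addr_ge0|move=> y yd].
  rewrite /D /gauss_density.
  have ts0 : 0 < t - s by lra.
  (* Here t - s >= (1 - q^2) t >= (1 - q)^2 t, and 1 / (1 - q) <= 1 + 2 q because q <= 1/2. *)
  have e1 : (Num.sqrt (2 * pi * (t - s)))^-1 <=
      (Num.sqrt (2 * pi * t))^-1 * expR (2 * q).
    apply: (@le_trans _ _ ((Num.sqrt (2 * pi * t))^-1 * (1 - q)^-1)).
      have pi0 := pi_gt0 R.
      have E : Num.sqrt (2 * pi * t) * (1 - q) = Num.sqrt (2 * pi * t * (1 - q) ^+ 2).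
        by rewrite (sqrtrM ((1 - q) ^+ 2)) ?sqrtr_sqr ?(ger0_norm (ltW q_lt1))// !mulr_ge0// ltW.
      rewrite -invfM E.
      rewrite lef_pV2 ?posrE ?sqrtr_gt0 ?mulr_gt0 ?exprn_gt0//.
      apply: ler_wsqrtr; rewrite -!mulrA ler_wpM2l// ler_wpM2l ?ltW//.
      nra.
    rewrite ler_wpM2l ?invr_ge0 ?sqrtr_ge0//.
    apply: le_trans (expR_ge1Dx _).
    rewrite -[leLHS]mul1r ler_pdivrMr//; nra.
  (* Replacing t - s by t only increases the exponential. Then y^2 - b^2 >= 2 b (y - b), where y
     differs from b by at most |a| + r + r' <= (C + 2) q sqrt t. *)
  have e2 : expR (- (y ^+ 2 / (2 * (t - s)))) <=
     expR (- (b ^+ 2 / (2 * t))) * expR ((C ^+ 2 + 2 * C) * q).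
    rewrite -expRD ler_expR.
    apply: (@le_trans _ _ (- (y ^+ 2 / (2 * t)))).
      rewrite lerN2 ler_wpM2l ?sqr_ge0// lef_pV2 ?posrE ?mulr_gt0//; lra.
    rewrite -lerN2 opprD !opprK.
    rewrite -(@ler_pM2r _ (2 * t)) ?mulr_gt0// mulrDl !divfK ?gt_eqF ?mulr_gt0//.
    have ub : `|y - b| <= (C + 2) * q * Num.sqrt t.
      have -> : y - b = (y - (b - a)) - a by ring.
      apply: le_trans (ler_normB _ _) _.
      have h1 : C * Num.sqrt s <= C * (q * Num.sqrt t) by rewrite ler_wpM2l.
      have h2 : q * r' <= 1 * (q * Num.sqrt t).
        apply: ler_pM => //; lra.
      lra.
    have h3 : - (b * (y - b)) <= C * Num.sqrt t * ((C + 2) * q * Num.sqrt t).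
      apply: le_trans (ler_norm _) _; rewrite normrN normrM.
      by apply: ler_pM.
    have h4 : C * Num.sqrt t * ((C + 2) * q * Num.sqrt t) = (C ^+ 2 + 2 * C) * q * t.
      by rewrite -{3}Sq; ring.
    have -> : y ^+ 2 = b ^+ 2 + 2 * (b * (y - b)) + (y - b) ^+ 2 by ring.
    have := sqr_ge0 (y - b); rewrite h4 in h3; lra.
  apply: le_trans (ler_pM _ _ e1 e2) _; rewrite ?invr_ge0 ?sqrtr_ge0 ?expR_ge0//.
  have -> : (C ^+ 2 + 2 * C + 2) * q = 2 * q + (C ^+ 2 + 2 * C) * q by ring.
  by rewrite (expRD (2 * q)) le_eqVlt; apply/orP; left; apply/eqP; ring.
apply: le_trans up _.
have h5 : r + r' <= r' * expR q.
  apply: (@le_trans _ _ (r' * (1 + q))); first lra.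
  by rewrite ler_wpM2l// expR_ge1Dx.
have -> : (C ^+ 2 + 3 * C + 4) * q = (C + 1) * q + (q + (C ^+ 2 + 2 * C + 2) * q)
  by ring.
have D0 : 0 <= D by rewrite mulr_ge0 ?gauss_density_ge0 ?expR_ge0.
apply: (@le_trans _ _ (2 * (r' * expR q) * D)).
  by rewrite ler_wpM2r// ler_wpM2l.
rewrite /D [in leRHS]expRN !expRD.
set X1 := expR ((C + 1) * q); set X2 := expR q; set X3 := expR (_ * q).
have X10 : 0 < X1 by rewrite expR_gt0.
by rewrite le_eqVlt; apply/orP; left; apply/eqP; field; rewrite gt_eqF.
Qed.

(** Whatever its target, the increment hits a window of half-width 2 r with probability at most 2 r
    / sqrt (t - s); dividing by the lower bound [near_const C * (r / sqrt t)] leaves the singular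
    factor. *)
Lemma near_event2_close s t a b r C : 0 < s -> s < t -> 0 <= C ->
  `|b| <= C * Num.sqrt t -> 0 < r -> r <= Num.sqrt t ->
  Pr (near_event s a r `&` near_event t b r) <=
  Pr (near_event s a r) * Pr (near_event t b r) *
  (2 / near_const C * (Num.sqrt t / Num.sqrt (t - s))).
Proof.
move=> s0 st C0 bC r0 rS.
have t0 : 0 < t by lra.
apply: le_trans (near_event2_le hB a b r r s0 st) _.
rewrite -[leRHS]mulrA; apply: ler_wpM2l; first exact: Pr_ge0.
apply: (le_trans (increment_ball_le_ratio _ (ltW s0) st (addr_ge0 (ltW r0) (ltW r0)))).
have low := near_event_ge_ratio t0 (ltW r0) C0 bC rS.
have c0 := near_const_gt0 C.
have S0 : 0 < Num.sqrt t by rewrite sqrtr_gt0.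
have V0 : 0 < Num.sqrt (t - s) by rewrite sqrtr_gt0 subr_gt0.
apply: le_trans (ler_wpM2r _ low); last first.
  by rewrite !mulr_ge0// ?invr_ge0 ?ltW.
rewrite le_eqVlt; apply/orP; left; apply/eqP; field.
by rewrite !gt_eqF.
Qed.

End boundary_estimates.

(** * Riemann sums of negative powers *)

Section power_sums.
Context {R : realType}.
Implicit Types a b : R.

(** A discrete mean value inequality for x^b, with half of the derivative, made to telescope. With x
    = 1 / (m + 1) and y = b x it follows from (1 - x)^b <= exp (- y) <= 1 / (1 + y) <= 1 - y / 2. *)
Lemma powR_step_ge b (m : nat) : 0 < b <= 1 ->
  m%:R `^ b + b / 2 * m.+1%:R `^ (b - 1) <= (m.+1%:R : R) `^ b.
Proof.
move=> /andP[b0 b1].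
have p0 : 0 < m.+1%:R :> R by rewrite ltr0n.
have -> : m.+1%:R `^ (b - 1) = m.+1%:R `^ b / m.+1%:R :> R.
  rewrite powRB; last by apply/implyP => _; rewrite gt_eqF.
  by rewrite powRr1// ltW.
have q0 : 0 < m.+1%:R `^ b :> R by rewrite powR_gt0.
pose x : R := m.+1%:R^-1.
have x0 : 0 < x by rewrite invr_gt0.
have x1 : x <= 1 by rewrite invf_le1// ler1n.
have mE : m%:R = m.+1%:R * (1 - x) :> R.
  by rewrite mulrBr mulr1 divff ?gt_eqF// -natr1; ring.
rewrite {1}mE powRM ?subr_ge0//.
rewrite -/x mulrCA -mulrDr ler_piMr//.
have h : (1 - x) `^ b <= (1 + b * x)^-1.
  have [->|xne] := eqVneq x 1.
    rewrite subrr powR0 ?gt_eqF// invr_ge0 addr_ge0// mulr1; exact: ltW.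
  have x1' : 0 < 1 - x by rewrite subr_gt0 lt_neqAle xne.
  rewrite /powR gt_eqF// -[leRHS]opprK.
  apply: (@le_trans _ _ (expR (- (b * x)))).
    rewrite ler_expR -mulrN ler_wpM2l ?(ltW b0)//.
        by apply: le_ln1Dx; rewrite ltrN2 lt_neqAle xne.
  rewrite opprK expRN lef_pV2 ?posrE ?expR_gt0//; last by rewrite addr_gt0// mulr_gt0.
  exact: expR_ge1Dx.
apply: le_trans (lerD h (lexx _)) _.
have bx : 0 < b * x by rewrite mulr_gt0.
have bx1 : b * x <= 1 by rewrite -[leRHS]mul1r ler_pM// ltW.
rewrite -[X in X + _]mul1r -lerBrDr ler_pdivrMr; last by lra.
set y := b * x in bx bx1 *.
have -> : b / 2 * x = y / 2 by rewrite /y; ring.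
nra.
Qed.

Lemma power_sum_le b (N : nat) : 0 < b <= 1 ->
  \sum_(m < N) (m.+1%:R : R) `^ (b - 1) <= 2 / b * N%:R `^ b.
Proof.
move=> hb; have /andP[b0 b1] := hb.
elim: N => [|N IH].
  by rewrite big_ord0 powR0 ?gt_eqF// mulr0.
rewrite big_ord_recr/=; apply: le_trans (lerD IH (lexx _)) _.
have := powR_step_ge N hb.
rewrite -(@ler_pM2l _ (2 / b)) ?divr_gt0// mulrDr.
by rewrite [2 / b * (_ * _)](_ : _ = N.+1%:R `^ (b - 1))//; field; rewrite gt_eqF.
Qed.

(** A Riemann sum of x^(-a) over (0, 1], bounded by twice the integral. It serves both the energy
    and, with a = 1/2, the count of the upper bound. *)
Lemma power_mean_le a (N : nat) : (0 < N)%N -> 0 <= a < 1 ->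
  \sum_(m < N) (m.+1%:R / N%:R : R) `^ (- a) <= 2 / (1 - a) * N%:R.
Proof.
move=> N0 /andP[a0 a1].
have N0' : 0 < N%:R :> R by rewrite ltr0n.
have hb : 0 < 1 - a <= 1 by apply/andP; split; lra.
have := power_sum_le N hb.
have -> : (1 - a - 1) = - a by ring.
rewrite -(@ler_pM2l _ (N%:R `^ a)) ?powR_gt0//.
have -> : N%:R `^ a * (2 / (1 - a) * N%:R `^ (1 - a)) = 2 / (1 - a) * N%:R.
  rewrite mulrCA -powRD; last by apply/implyP => _; rewrite gt_eqF.
  have -> : a + (1 - a) = 1 by ring.
  rewrite powRr1// ltW.
apply: le_trans; rewrite mulr_sumr; apply: ler_sum => m _.
rewrite powRM ?invr_ge0// mulrC -[N%:R^-1]powR_inv1// -powRrM mulrNN mul1r//.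
Qed.

(** One of the two truncated differences vanishes, so this is |i - j|. *)
Definition natdist (i j : nat) : nat := (i - j + (j - i))%N.

Lemma natdistC i j : natdist i j = natdist j i.
Proof. by rewrite /natdist addnC. Qed.

(** Each distance to i is attained at most twice, once on either side. *)
Lemma sum_natdist_le (g : nat -> R) (N i : nat) : (forall m, 0 <= g m) ->
  (i < N)%N -> \sum_(j < N) g (natdist i j) <= 2 * \sum_(m < N) g m.
Proof.
move=> g0 iN.
rewrite -(big_mkord xpredT (fun j => g (natdist i j))) -(big_mkord xpredT g).
rewrite (@big_cat_nat _ _ _ i.+1)//= mulr2n mulrDl !mul1r.
have sub k : (k <= N)%N -> \sum_(0 <= m < k) g m <= \sum_(0 <= m < N) g m.
  move=> kN; rewrite (@big_cat_nat _ _ _ k 0 N)//= lerDl.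
  by apply: sumr_ge0.
apply: lerD.
  apply: le_trans (sub i.+1 iN).
  rewrite big_nat_rev/= !big_mkord; apply: ler_sum => m _.
  rewrite add0n /natdist subSS (subKn (ltn_ord m : (m <= i)%N)).
  by rewrite (eqP (leq_subr m i : _ - _ == 0)%N) addn0.
apply: le_trans (sub (N - i)%N (leq_subr _ _)).
rewrite -(subnSK iN) big_nat_recl// -{1}[i.+1]add0n big_addn.
rewrite ler_wpDl// !big_mkord; apply: ler_sum => m _.
rewrite /natdist addnS -addSn addnK.
by have /eqP -> : (i - (m.+1 + i) == 0)%N by rewrite subn_eq0 leq_addl.
Qed.

Lemma kernel_sum_le a (N : nat) : (0 < N)%N -> 0 <= a < 1 ->
  \sum_(i < N) \sum_(j < N) ((natdist i j).+1%:R / N%:R : R) `^ (- a) <=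
  4 / (1 - a) * N%:R ^+ 2.
Proof.
move=> N0 ha.
apply: (@le_trans _ _ (\sum_(i < N) (4 / (1 - a) * N%:R))).
  apply: ler_sum => i _.
  apply: le_trans (sum_natdist_le (g := fun m => (m.+1%:R / N%:R) `^ (- a)) _ (ltn_ord i)) _.
    by move=> m; rewrite powR_ge0.
  have := power_mean_le N0 ha; lra.
by rewrite sumr_const card_ord -[X in X <= _]mulr_natr expr2 !mulrA lexx.
Qed.

End power_sums.

(** * Moments of the random mass and of its energy *)

Section second_moment.
Context {R : realType} {d : measure_display} {T : measurableType d}.
Variables (P : probability T R) (K N : nat) (A : 'I_K -> 'I_N -> set T).
Variables (kappa C1 : R).
Local Notation Pr := (Pr P).
Local Notation h i j := ((natdist i j).+1%:R / N%:R : R).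

(** Normalised so that every point carries mean mass 1 / N and every scale mean mass 1. *)
Definition hit_weight k i : R := (N%:R * Pr (A k i))^-1.

Definition hit_mass w : R := \sum_k \sum_i hit_weight k i * \1_(A k i) w.

(** Only pairs within one scale enter, with distances in units of that scale; the successor in [h]
    keeps the diagonal terms finite. *)
Definition hit_energy (s : R) w : R := \sum_k \sum_i \sum_j
  hit_weight k i * hit_weight k j * h i j `^ (- s) * \1_(A k i `&` A k j) w.

Hypotheses (K0 : (0 < K)%N) (N0 : (0 < N)%N).
Hypotheses (kappa0 : 0 <= kappa) (C10 : 0 <= C1).
Hypothesis mA : forall k i, measurable (A k i).
Hypothesis A0 : forall k i, 0 < Pr (A k i).
Hypothesis far : forall k k' i j, k != k' ->
  Pr (A k i `&` A k' j) <= Pr (A k i) * Pr (A k' j) * (1 + kappa).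
Hypothesis close : forall k i j,
  Pr (A k i `&` A k j) <= Pr (A k i) * Pr (A k j) * (C1 * h i j `^ (- (1 / 2))).

Let N0' : 0 < N%:R :> R. Proof. by rewrite ltr0n. Qed.
Let K0' : 0 < K%:R :> R. Proof. by rewrite ltr0n. Qed.

Let wt0 k i : 0 <= hit_weight k i.
Proof. by rewrite invr_ge0 mulr_ge0// ltW. Qed.

Let wtE k i : hit_weight k i * Pr (A k i) = N%:R^-1.
Proof. by rewrite /hit_weight invfM mulfVK// gt_eqF. Qed.

Let wt2_le k k' i j (x : R) :
  Pr (A k i `&` A k' j) <= Pr (A k i) * Pr (A k' j) * x ->
  hit_weight k i * hit_weight k' j * Pr (A k i `&` A k' j) <= N%:R ^- 2 * x.
Proof.
move=> H; apply: le_trans (ler_wpM2l _ H) _; first exact: mulr_ge0.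
by rewrite mulrA mulrACA !wtE expr2 invfM.
Qed.

Let kernel_mean_le (a : R) : 0 <= a < 1 ->
  \sum_(i < N) \sum_(j < N) N%:R ^- 2 * (C1 * h i j `^ (- a)) <= C1 * (4 / (1 - a)).
Proof.
move=> ha.
under eq_bigr do rewrite -mulr_sumr.
under eq_bigr do rewrite -mulr_sumr.
rewrite -!mulr_sumr.
have S := kernel_sum_le N0 ha.
rewrite mulrCA ler_wpM2l// mulrC ler_pdivrMr// exprn_gt0//.
Qed.

(** Each of the K^2 pairs of scales contributes at most 1 + kappa, apart from the K equal pairs,
    bounded by C1 times the kernel constant 4 / (1 - 1/2) = 8. *)
Let second_moment_le :
  \sum_(x : 'I_K * 'I_N) \sum_(y : 'I_K * 'I_N)
    hit_weight x.1 x.2 * hit_weight y.1 y.2 * Pr (A x.1 x.2 `&` A y.1 y.2) <=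
  K%:R ^+ 2 * (1 + kappa) + 8 * C1 * K%:R.
Proof.
under eq_bigr do rewrite -(pair_bigA _ (fun k' j =>
  hit_weight _ _ * hit_weight k' j * Pr (_ `&` A k' j))).
rewrite -(pair_bigA _ (fun k i => \sum_k' \sum_j
  hit_weight k i * hit_weight k' j * Pr (A k i `&` A k' j)))/=.
apply: (@le_trans _ _ (\sum_(k < K) \sum_(k' < K)
    ((1 + kappa) + (k == k')%:R * (8 * C1)))).
  apply: ler_sum => k _; rewrite exchange_big/=; apply: ler_sum => k' _.
  have [<-|kk'] := eqVneq k k'; last first.
    rewrite mul0r addr0.
    apply: (@le_trans _ _ (\sum_(i < N) \sum_(j < N) (N%:R ^- 2 * (1 + kappa)))).
      by apply: ler_sum => i _; apply: ler_sum => j _; apply: wt2_le; exact: far.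
    rewrite !sumr_const card_ord -mulrnA -[X in X <= _]mulr_natr natrM.
    rewrite le_eqVlt; apply/orP; left; apply/eqP; field.
    by rewrite gt_eqF.
  apply: (@le_trans _ _ (C1 * (4 / (1 - 1 / 2)))); last first.
    have -> : 4 / (1 - 1 / 2) = 8 :> R by field.
    rewrite [X in _ + X]mul1r; have := kappa0. lra.
  apply: le_trans (kernel_mean_le _); last by apply/andP; split; lra.
  by apply: ler_sum => i _; apply: ler_sum => j _; apply: wt2_le; exact: close.
under eq_bigr do rewrite big_split/=.
rewrite big_split/=; apply: lerD.
  rewrite !sumr_const card_ord -mulrnA -[X in X <= _]mulr_natr natrM.
  by rewrite mulrC expr2.
apply: (@le_trans _ _ (\sum_(k < K) 8 * C1)).
  apply: ler_sum => k _; rewrite (bigD1 k)//= eqxx mul1r big1 ?addr0// => k'.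
  by rewrite eq_sym => /negbTE ->; rewrite mul0r.
by rewrite sumr_const card_ord -[X in X <= _]mulr_natr.
Qed.

(** The correlation within a scale adds 1/2 to the exponent of the kernel, and s < 1/2 keeps the
    total 1/2 + s below 1. *)
Let energy_mean_le (s : R) : 0 <= s < 1 / 2 ->
  \sum_(k < K) \sum_(i < N) \sum_(j < N)
    hit_weight k i * hit_weight k j * h i j `^ (- s) * Pr (A k i `&` A k j) <=
  K%:R * (C1 * (4 / (1 / 2 - s))).
Proof.
move=> /andP[s0 s1].
apply: (@le_trans _ _ (\sum_(k < K) C1 * (4 / (1 / 2 - s)))); last first.
  by rewrite sumr_const card_ord -[X in X <= _]mulr_natr mulrC.
apply: ler_sum => k _.
have -> : 1 / 2 - s = 1 - (1 / 2 + s) by lra.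
apply: le_trans (kernel_mean_le _); last by apply/andP; split; lra.
apply: ler_sum => i _; apply: ler_sum => j _.
rewrite mulrAC.
have hp : 0 < h i j by rewrite divr_gt0.
have -> : N%:R ^- 2 * (C1 * h i j `^ (- (1 / 2 + s))) =
    N%:R ^- 2 * (C1 * h i j `^ (- (1 / 2))) * h i j `^ (- s).
  rewrite opprD powRD; last by apply/implyP => _; rewrite gt_eqF.
  by ring.
by apply: ler_wpM2r; [exact: powR_ge0|apply: wt2_le; exact: close].
Qed.

(** The variance is at most K^2 kappa + 8 C1 K. Chebyshev with deviation K / 2 divides it by K^2 /
    4, which gives the first two terms; the third is Markov for the energy. *)
Lemma hit_mass_energy (s L : R) : 0 <= s < 1 / 2 -> 0 < L ->
  exists G : set T, [/\ measurable G,
    (P G <= (4 * kappa + 32 * C1 / K%:R + K%:R * (C1 * (4 / (1 / 2 - s))) / L)%:E)%E &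
    forall w, ~ G w -> K%:R / 2 < hit_mass w /\ hit_energy s w < L].
Proof.
move=> hs L0.
pose u (x : 'I_K * 'I_N) := hit_weight x.1 x.2.
pose Au (x : 'I_K * 'I_N) := A x.1 x.2.
have x0 : 0 < (K%:R / 2) ^+ 2 :> R by rewrite exprn_gt0// divr_gt0.
have [mG1 PG1] := @chebyshev_simple _ _ _ P _ u Au K%:R _ (fun x => mA _ _) x0.
pose I2 := ('I_K * ('I_N * 'I_N))%type.
pose c (x : I2) := hit_weight x.1 x.2.1 * hit_weight x.1 x.2.2 * h x.2.1 x.2.2 `^ (- s).
pose A2 (x : I2) := A x.1 x.2.1 `&` A x.1 x.2.2.
have mA2 x : measurable (A2 x) by apply: measurableI.
have c0 x : 0 <= c x by rewrite !mulr_ge0// powR_ge0.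
have sum2 (G : set T -> R) : \sum_x c x * G (A2 x) = \sum_k \sum_i \sum_j
  hit_weight k i * hit_weight k j * h i j `^ (- s) * G (A k i `&` A k j).
  under [RHS]eq_bigr do rewrite pair_bigA/=.
  by rewrite pair_bigA/=.
have sum1 (G : set T -> R) : \sum_x u x * G (Au x) =
    \sum_k \sum_i hit_weight k i * G (A k i).
  by rewrite pair_bigA.
have mG2 : measurable [set w | L <= \sum_x c x * \1_(A2 x) w].
  exact: measurable_simple_ge.
have PG2 : (P [set w | (L <= \sum_x c x * \1_(A2 x) w)%R] <=
   ((\sum_x c x * Pr (A2 x)) / L)%:E)%E.
  by apply: markov_simple => // w; apply: sumr_ge0 => x _; rewrite mulr_ge0.
eexists; split; first exact: measurableU mG1 mG2.
- apply: le_trans (measureU2 _ mG1 mG2) _.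
  apply: le_trans (leeD PG1 PG2) _.
  rewrite -EFinD lee_fin; apply: lerD; last first.
    by rewrite ler_wpM2r ?invr_ge0 ?(ltW L0)// (sum2 Pr); exact: energy_mean_le.
  have -> : \sum_x u x * Pr (Au x) = K%:R.
    rewrite (sum1 Pr); under eq_bigr do (under eq_bigr do rewrite wtE).
    by rewrite !sumr_const !card_ord -[X in X *+ K]mulr_natl divff ?gt_eqF.
  rewrite ler_pdivrMr//.
  apply: (@le_trans _ _ (K%:R ^+ 2 * (1 + kappa) + 8 * C1 * K%:R -
       2 * K%:R * K%:R + K%:R ^+ 2)).
    by rewrite lerD2r lerD2r second_moment_le.
  rewrite le_eqVlt; apply/orP; left; apply/eqP; field.
  by rewrite gt_eqF.
- move=> w /not_orP[/= /negP + /negP]; rewrite -!ltNge (sum1 (fun X => \1_X w)).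
  rewrite (sum2 (fun X => \1_X w)) => h1 h2; split=> //.
  rewrite ltNge; apply/negP => h3; move: h1; apply/negP; rewrite -leNgt.
  rewrite lerXn2r// ?nnegrE; first by rewrite ltW// divr_gt0.
  + move: h3; rewrite /hit_mass; have := K0'; lra.
  + move: h3; rewrite /hit_mass; have := K0'; lra.
Qed.

End second_moment.

(** * Coverings of a zero set and the energy method *)

Section covers.
Context {R : realType}.
Implicit Types (s x y r t : R) (g : R -> R).

(** With X the mass of a cell, 2 X <= lam b + X^2 / (b lam), and X^2 / b is at most the energy of
    the pairs inside the cell. The parameter [lam] is left free for the balance between the two
    sums. *)
Lemma mass_energy_cells (I J : finType) (a : I -> R) (idx : I -> J)
    (ker : I -> I -> R) (b : J -> R) (lam : R) :
  (forall i, 0 <= a i) -> (forall i j, 0 <= ker i j) -> (forall l, 0 < b l) ->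
  0 < lam ->
  (forall i j, a i != 0 -> a j != 0 -> idx i = idx j ->
    (b (idx i))^-1 <= ker i j) ->
  2 * \sum_i a i <= lam * \sum_l b l + (\sum_i \sum_j a i * a j * ker i j) / lam.
Proof.
move=> a0 ker0 b0 lam0 H.
pose X l := \sum_(i | idx i == l) a i.
have h1 l : 2 * X l <= lam * b l + X l * X l / b l / lam.
  have := sqr_ge0 (lam * b l - X l) => h.
  rewrite -subr_ge0.
  have -> : lam * b l + X l * X l / b l / lam - 2 * X l =
     (lam * b l - X l) ^+ 2 / (lam * b l).
    by field; rewrite !gt_eqF.
  by rewrite divr_ge0// mulr_ge0 ?ltW.
rewrite (partition_big idx xpredT)//= mulr_sumr.
apply: le_trans (ler_sum _ (fun l _ => h1 l)) _.
rewrite big_split/= -mulr_sumr lerD2l -mulr_suml ler_wpM2r ?invr_ge0 ?(ltW lam0)//.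
rewrite [leRHS](partition_big idx xpredT)//=; apply: ler_sum => l _.
rewrite {1}/X -mulrA mulr_suml; apply: ler_sum => i /eqP il.
rewrite /X mulr_suml mulr_sumr.
rewrite [leRHS](bigID (fun j => idx j == l))/= ler_wpDr//.
  by apply: sumr_ge0 => j _; rewrite !mulr_ge0.
apply: ler_sum => j /eqP jl; rewrite -mulrA.
have [->|ai] := eqVneq (a i) 0; first by rewrite !mul0r.
have [->|aj] := eqVneq (a j) 0; first by rewrite !mul0r.
by do 2 (apply: ler_wpM2l => //); rewrite -il H// il jl.
Qed.

(** Centre the ball at any point of the set, with the diameter as radius. The empty set, of diameter
    -oo, gets radius 0, whose power is 0 because s > 0. *)
Lemma diam_pow_ball s (E : set R) : 0 < s -> (diam_pow s E < +oo)%E ->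
  exists x r, [/\ 0 <= r, (forall y, E y -> `|y - x| <= r) &
    ((r `^ s)%:E <= diam_pow s E)%E].
Proof.
move=> s0; rewrite /diam_pow; case: ifP => [/eqP -> _|/negbT/set0P[x Ex]].
  by exists 0, 0; split=> //; rewrite powR0// gt_eqF.
have ub y : E y -> (`|y - x|%:E <= diam E)%E.
  by move=> Ey; apply: ereal_sup_ubound; exists y => //; exists x.
have d0 : (0 <= diam E)%E by have := ub x Ex; rewrite subrr normr0.
case: (diam E) ub d0 => [r||] ub d0 // h; last by rewrite poweRyr ?gt_eqF in h.
by exists x, r; split.
Qed.

(** Continuity relative to (0, 1], since nothing is known about [f] beyond time 1. *)
Definition continuous_on01 g := forall t e, 0 < t <= 1 -> 0 < e ->
  exists2 dl, 0 < dl & forall u, 0 < u <= 1 -> `|u - t| < dl -> `|g u - g t| < e.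

(** Otherwise there are points [u m], with |g (u m)| <= 1 / (m + 1), outside the first m + 1 balls.
    They accumulate at a zero of g, which lies in one of the open balls; [tau] keeps the limit away
    from time 0. *)
Lemma near_zeros_covered g (tau : R) (x r : nat -> R) :
  continuous_on01 g -> 0 < tau <= 1 ->
  (forall t, 0 < t <= 1 -> g t = 0 -> exists i, `|t - x i| < r i) ->
  exists m, forall t, tau <= t <= 1 -> `|g t| <= m.+1%:R^-1 ->
    exists2 i, (i <= m)%N & `|t - x i| < r i.
Proof.
move=> cg /andP[tau0 tau1] cov; apply: contrapT => nex.
have [u Hu] : {u : nat -> R & forall m, [/\ tau <= u m <= 1, `|g (u m)| <= m.+1%:R^-1 &
    forall i, (i <= m)%N -> r i <= `|u m - x i|]}.
  apply: (@choice _ _ (fun m v => [/\ tau <= v <= 1, `|g v| <= m.+1%:R^-1 &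
    forall i, (i <= m)%N -> r i <= `|v - x i|])) => m.
  apply: contrapT => nv; apply: nex; exists m => t t01 gt; apply: contrapT => ni.
  apply: nv; exists t; split=> // i im; rewrite leNgt; apply/negP => ti.
  by apply: ni; exists i.
have cI : compact `[tau, 1]%classic by exact: segment_compact.
have [|t [/= tI ct]] := cI (u @ \oo) _.
  by exists 0%N => // m _ /=; rewrite in_itv/=; case: (Hu m).
move: tI; rewrite in_itv/= => /andP[taut t1].
have t01 : 0 < t <= 1 by rewrite t1 andbT; exact: lt_le_trans taut.
have meet (dl : R) n0 : 0 < dl ->
    exists2 m, (n0 <= m)%N & `|u m - t| < dl.
  move=> dl0.
  have [] := ct [set v | exists2 m, (n0 <= m)%N & v = u m] (ball t dl).
  - by exists n0 => // m n0m; exists m.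
  - exact: nbhsx_ballx.
  - move=> v [[m n0m ->]]; rewrite -ball_normE/= distrC => um; by exists m.
have um01 m : 0 < u m <= 1.
  by have [/andP[h1 ->] _ _] := Hu m; rewrite andbT; exact: lt_le_trans h1.
have gt0 : g t = 0.
  apply/eqP; apply: contrapT => /negP gtn.
  have e0 : 0 < `|g t| / 2 by rewrite divr_gt0// normr_gt0.
  have [dl dl0 Hdl] := cg t _ t01 e0.
  have [m mm um] := meet dl (Num.trunc (`|g t| / 2)^-1) dl0.
  have [_ gum _] := Hu m.
  have h1 := Hdl _ (um01 m) um.
  have h2 : m.+1%:R^-1 < `|g t| / 2.
    rewrite invf_plt ?posrE//; apply: lt_le_trans (truncnS_gt _) _.
    by rewrite ler_nat ltnS.
  have h3 : `|g t| <= `|g (u m)| + `|g (u m) - g t|.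
    have := ler_normB (g (u m)) (g (u m) - g t).
    by have -> : g (u m) - (g (u m) - g t) = g t by ring.
  have h4 := le_lt_trans gum h2; clear -h1 h3 h4; lra.
have [i ti] := cov t t01 gt0.
have dl0 : 0 < r i - `|t - x i| by rewrite subr_gt0.
have [m mm um] := meet _ i dl0.
have [_ _ /(_ i mm)] := Hu m.
have -> : u m - x i = (u m - t) + (t - x i) by ring.
have := ler_normD (u m - t) (t - x i); lra.
Qed.

(** A regular grid of the upper half of [0, theta^(2 k)]; the exponent is even so that square roots
    of times are comparable to theta^k. *)
Definition scale_time (theta : R) (N k i : nat) : R :=
  theta ^+ (2 * k) * (1 + i%:R / N%:R) / 2.

Lemma scale_time_itv (theta : R) (N k i : nat) : (i < N)%N -> 0 < theta < 1 ->
  theta ^+ (2 * k) / 2 <= scale_time theta N k i <= theta ^+ (2 * k).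
Proof.
move=> iN /andP[th0 _].
have N0 : 0 < N%:R :> R by rewrite ltr0n (leq_ltn_trans _ iN).
have q0 : 0 < theta ^+ (2 * k) by rewrite exprn_gt0.
have h0 : 0 <= i%:R / N%:R :> R by rewrite divr_ge0.
have h1 : i%:R / N%:R <= 1 :> R by rewrite ler_pdivrMr// mul1r ler_nat ltnW.
by rewrite /scale_time; apply/andP; split; nra.
Qed.

Lemma diam_pow_ge0 s (E : set R) : (0 <= diam_pow s E)%E.
Proof. by rewrite /diam_pow; case: ifP => // _; exact: poweR_ge0. Qed.

Lemma sum_half_pow_le (c : R) (m : nat) : 0 <= c ->
  \sum_(l < m) c / 2 ^+ l.+1 <= c.
Proof.
move=> c0.
suff -> : \sum_(l < m) c / 2 ^+ l.+1 = c - c / 2 ^+ m.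
  by rewrite gerBl divr_ge0// exprn_ge0.
elim: m => [|m IH]; first by rewrite big_ord0 expr0 divr1 subrr.
rewrite big_ord_recr/= IH exprS; field.
by rewrite expf_neq0.
Qed.

(** Two times in the ball are less than 2 r apart and the grid is stretched by at least tau =
    theta^(2 K) / 2, so |i - j| / N < 2 r / tau; the successor adds 1 / N <= r / tau, whence the
    3. *)
Lemma scale_time_cell (theta : R) (K N k i j : nat) x r : 0 < theta < 1 ->
  (k < K)%N -> (0 < N)%N -> N%:R^-1 <= r ->
  `|scale_time theta N k i - x| < r -> `|scale_time theta N k j - x| < r ->
  (natdist i j).+1%:R / N%:R <= 3 / (theta ^+ (2 * K) / 2) * r.
Proof.
move=> /andP[th0 th1] kK N0 Nr ti tj.
have N0' : 0 < N%:R :> R by rewrite ltr0n.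
set tau := theta ^+ (2 * K) / 2.
have tau0 : 0 < tau by rewrite divr_gt0// exprn_gt0.
have tau1 : tau <= 1.
  by rewrite /tau ler_pdivrMr// mul1r; apply: le_trans (exprn_ile1 _ _ _) _ => //; lra.
have tauk : 2 * tau <= theta ^+ (2 * k).
  rewrite /tau mulrCA divff// mulr1.
  by apply: ler_wiXn2l; [exact: ltW|exact: ltW|rewrite leq_mul2l ltnW// orbT].
have dE : `|scale_time theta N k i - scale_time theta N k j| =
    theta ^+ (2 * k) / 2 * ((natdist i j)%:R / N%:R).
  have -> : scale_time theta N k i - scale_time theta N k j =
     theta ^+ (2 * k) / 2 * ((i%:R - j%:R) / N%:R).
    by rewrite /scale_time; field; rewrite gt_eqF.
  rewrite normrM [X in X * _]ger0_norm ?divr_ge0 ?exprn_ge0 ?(ltW th0)// normrM.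
  congr (_ * (_ * _)); last by rewrite ger0_norm// invr_ge0.
  rewrite /natdist; case: (leqP i j) => ij.
    by rewrite (eqP (ij : (i - j == 0)%N)) add0n natrB// distrC ger0_norm// subr_ge0 ler_nat.
  rewrite (eqP (ltnW ij : (j - i == 0)%N)) addn0 natrB ?(ltnW ij)//.
  by rewrite ger0_norm// subr_ge0 ler_nat ltnW.
have dlt : `|scale_time theta N k i - scale_time theta N k j| < 2 * r.
  have -> : scale_time theta N k i - scale_time theta N k j =
    (scale_time theta N k i - x) - (scale_time theta N k j - x) by ring.
  by have := ler_normB (scale_time theta N k i - x) (scale_time theta N k j - x); lra.
rewrite dE in dlt.
have r0 : 0 < r by apply: lt_le_trans Nr; rewrite invr_gt0.
have D0 : 0 <= (natdist i j)%:R / N%:R :> R by rewrite divr_ge0.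
have h1 : 2 * tau * ((natdist i j)%:R / N%:R) <=
    theta ^+ (2 * k) * ((natdist i j)%:R / N%:R) by exact: ler_wpM2r.
have h2 : N%:R^-1 * tau <= N%:R^-1 * 1 by rewrite ler_wpM2l ?invr_ge0.
have -> : 3 / tau * r = 3 * r / tau by rewrite mulrAC.
rewrite ler_pdivlMr// -natr1 mulrDl mul1r.
set D := _ / N%:R in h1 dlt *; set Ni := N%:R^-1 in Nr h2 *.
clear -h1 h2 dlt Nr; lra.
Qed.

(* Frostman's energy argument with the weights a_n in place of a limit measure. *)
Lemma hausdorff_measure_neq0 g (K : nat) (theta s L : R) :
  continuous_on01 g -> (0 < K)%N -> 0 < theta < 1 -> 0 < s -> 0 < L ->
  (forall n0, exists n, (n0 <= n)%N /\
    exists a : 'I_K -> 'I_(n.+1 ^ 2) -> R, [/\ forall k i, 0 <= a k i,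
      forall k i, a k i != 0 ->
        `|g (scale_time theta (n.+1 ^ 2) k i)| <= n.+1%:R^-1,
      K%:R / 2 < \sum_k \sum_i a k i &
      \sum_k \sum_i \sum_j a k i * a k j *
        ((natdist i j).+1%:R / (n.+1 ^ 2)%:R) `^ (- s) < L]) ->
  hausdorff_measure s (zeros `[0, 1] g) <> 0%E.
Proof.
move=> cg K0 th s0 L0 Ha; have /andP[th0 th1] := th.
set tau := theta ^+ (2 * K) / 2.
have tau0 : 0 < tau by rewrite divr_gt0// exprn_gt0.
have tau1 : tau <= 1.
  by rewrite /tau ler_pdivrMr// mul1r; apply: le_trans (exprn_ile1 _ _ _) _ => //; lra.
have K0' : 0 < K%:R :> R by rewrite ltr0n.
have T0 : 0 < (3 / tau) `^ s by rewrite powR_gt0// divr_gt0.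
(* Chosen so that K lam (3 / tau)^s (2 c) = K / 2 for the [lam] below. *)
pose c : R := K%:R / (8 * L * (3 / tau) `^ s).
have c0 : 0 < c by rewrite divr_gt0// !mulr_gt0.
suff Hc : (c%:E <= hausdorff_premeasure s 1%R (zeros `[0%R, 1%R] g))%E.
  have c0E : (0 < c%:E)%E by rewrite lte_fin.
  apply/eqP; rewrite gt_eqF//; apply: lt_le_trans (lt_le_trans c0E Hc) _.
  by apply: ereal_sup_ubound; exists 1 => //=.
apply: le_ereal_inf_tmp => _ [E [Ecov _] <-]; rewrite leNgt; apply/negP => Esum.
have Ege i : (diam_pow s (E i) <= \sum_(0 <= i <oo) diam_pow s (E i))%E.
  apply: le_trans (nneseries_lim_ge i.+1 _); last by move=> *; exact: diam_pow_ge0.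
  by rewrite big_nat_recr//= leeDr// sume_ge0// => *; exact: diam_pow_ge0.
have [x Hx] : {x : nat -> R & forall i, exists r, [/\ 0 <= r,
    (forall y, E i y -> `|y - x i| <= r) & ((r `^ s)%:E <= diam_pow s (E i))%E]}.
  apply: (@choice _ _ (fun i x => exists r, [/\ 0 <= r,
    (forall y, E i y -> `|y - x| <= r) & ((r `^ s)%:E <= diam_pow s (E i))%E])) => i.
  apply: diam_pow_ball => //; apply: le_lt_trans (Ege i) _.
  by apply: lt_trans Esum _; rewrite ltry.
have [rd Hr] := choice Hx.
(* Radii enlarged to make the balls open, at a total cost of at most c in the sum of s-th powers. *)
pose r i : R := (rd i `^ s + c / 2 ^+ i.+1) `^ s^-1.
have base0 i : 0 < rd i `^ s + c / 2 ^+ i.+1.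
  by rewrite ltr_wpDl ?powR_ge0// divr_gt0// exprn_gt0.
have r0 i : 0 < r i by rewrite powR_gt0.
have rs i : r i `^ s = rd i `^ s + c / 2 ^+ i.+1.
  by rewrite /r -powRrM mulVf ?gt_eqF// powRr1// ltW.
have rdr i : rd i < r i.
  rewrite ltNge; apply/negP => h.
  have : r i `^ s <= rd i `^ s.
    apply: (ge0_ler_powR (ltW s0)) => //; rewrite nnegrE; first exact: ltW.
    by case: (Hr i).
  by rewrite rs gerDl leNgt divr_gt0// exprn_gt0.
have sum_r m : \sum_(l < m) r l `^ s <= 2 * c.
  under eq_bigr do rewrite rs.
  rewrite big_split/= mulr2n mulrDl !mul1r lerD ?sum_half_pow_le ?(ltW c0)//.
  rewrite -lee_fin -sumEFin; apply: le_trans (ltW Esum).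
  apply: le_trans (nneseries_lim_ge m _); last by move=> *; exact: diam_pow_ge0.
  by rewrite big_mkord; apply: lee_sum => l _; case: (Hr l).
have cov t : 0 < t <= 1 -> g t = 0 -> exists i, `|t - x i| < r i.
  move=> /andP[t0 t1] gt.
  have [|i _ Eit] := Ecov t; first by split=> //=; rewrite in_itv/= t1 ltW.
  by exists i; have [_ /(_ t Eit) h _] := Hr i; exact: le_lt_trans (rdr i).
have tau01 : 0 < tau <= 1 by rewrite tau0.
have [m Hm] := near_zeros_covered cg tau01 cov.
(* From [n1] on, the mesh 1 / N is below each of the finitely many radii. *)
pose n1 := \max_(l < m.+1) Num.trunc (r l)^-1.
have [n [nn [a [a0 ag aM aE]]]] := Ha (maxn m n1).
have nm : (m <= n)%N by apply: leq_trans nn; exact: leq_maxl.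
have nr (l : 'I_m.+1) : (n.+1 ^ 2)%:R^-1 <= r l.
  apply: (@le_trans _ _ n.+1%:R^-1).
    by rewrite lef_pV2 ?posrE ?ltr0n ?expn_gt0// ler_nat expnS expn1 leq_pmulr.
  rewrite invf_ple ?posrE ?ltr0n//; apply: ltW; apply: lt_le_trans (truncnS_gt _) _.
  rewrite ler_nat ltnS; apply: leq_trans (leq_trans (leq_maxr m n1) nn).
  exact: (leq_bigmax_cond (F := fun l : 'I_m.+1 => Num.trunc (r l)^-1)).
have N0 : (0 < n.+1 ^ 2)%N by rewrite expn_gt0.
have stI (k : 'I_K) (i : 'I_(n.+1 ^ 2)) : tau <= scale_time theta (n.+1 ^ 2) k i <= 1.
  have /andP[h1 h2] := scale_time_itv k (ltn_ord i) th.
  apply/andP; split.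
    apply: le_trans h1; rewrite /tau ler_wpM2r//.
    by apply: ler_wiXn2l; [exact: ltW|exact: ltW|rewrite leq_mul2l ltnW// orbT].
  by apply: le_trans h2 _; apply: exprn_ile1; exact: ltW.
have [idx Hidx] : {idx : 'I_K * 'I_(n.+1 ^ 2) -> 'I_m.+1 & forall z,
    a z.1 z.2 != 0 -> `|scale_time theta (n.+1 ^ 2) z.1 z.2 - x (idx z)| < r (idx z)}.
  apply: (@choice _ _ (fun z (l : 'I_m.+1) => a z.1 z.2 != 0 ->
     `|scale_time theta (n.+1 ^ 2) z.1 z.2 - x l| < r l)) => -[k i] /=.
  have [_|ane] := eqVneq (a k i) 0; first by exists ord0.
  have [|l lm Hl] := Hm _ (stI k i); last by exists (Ordinal (lm : l < m.+1)%N).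
  apply: le_trans (ag k i ane) _.
  by rewrite lef_pV2 ?posrE ?ltr0n// ler_nat ltnS.
pose b (l : 'I_m.+1) := (3 / tau * r l) `^ s.
have b0 l : 0 < b l by rewrite powR_gt0// mulr_gt0// divr_gt0.
(* Makes the energy term less than L / lam = K / 2. The covering term is at most K / 2 too, while
   twice the mass exceeds K. *)
pose lam := 2 * L / K%:R.
have lam0 : 0 < lam by rewrite divr_gt0// mulr_gt0.
have step (k : 'I_K) : 2 * \sum_i a k i <= lam * \sum_l b l +
    (\sum_i \sum_j a k i * a k j *
        ((natdist i j).+1%:R / (n.+1 ^ 2)%:R) `^ (- s)) / lam.
  apply: (@mass_energy_cells _ _ (a k) (fun i => idx (k, i))
    (fun i j => ((natdist i j).+1%:R / (n.+1 ^ 2)%:R) `^ (- s))) => //.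
  move=> i j ai aj ij.
  have h0 : 0 < (natdist i j).+1%:R / (n.+1 ^ 2)%:R :> R by rewrite divr_gt0 ?ltr0n.
  have q0 : 0 < 3 / tau * r (idx (k, i)) by rewrite mulr_gt0// divr_gt0.
  rewrite powRN lef_pV2 ?posrE ?powR_gt0//.
  apply: (ge0_ler_powR (ltW s0)); rewrite ?nnegrE; [exact: ltW|exact: ltW|].
  apply: scale_time_cell (nr _) (Hidx (k, i) ai) _ => //.
  by rewrite ij; exact: (Hidx (k, j) aj).
have sumb : \sum_l b l <= (3 / tau) `^ s * (2 * c).
  have bE l : b l = (3 / tau) `^ s * r l `^ s.
    by apply: powRM; rewrite ltW// divr_gt0.
  under eq_bigr do rewrite bE.
  by rewrite -mulr_sumr ler_wpM2l// ?powR_ge0.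
have fin : 2 * \sum_k \sum_i a k i <= K%:R * (lam * \sum_l b l) +
    (\sum_k \sum_i \sum_j a k i * a k j *
        ((natdist i j).+1%:R / (n.+1 ^ 2)%:R) `^ (- s)) / lam.
  rewrite mulr_sumr; apply: le_trans (ler_sum _ (fun k _ => step k)) _.
  by rewrite big_split/= sumr_const card_ord -[X in X + _]mulr_natl mulr_suml lexx.
move: fin; apply/negP; rewrite -ltNge.
have e1 : K%:R * (lam * \sum_l b l) <= K%:R / 2.
  apply: (@le_trans _ _ (K%:R * (lam * ((3 / tau) `^ s * (2 * c))))).
    by rewrite ler_wpM2l// ler_wpM2l// ltW.
  rewrite /lam /c le_eqVlt; apply/orP; left; apply/eqP; field.
  by rewrite !gt_eqF.
have e2 : (\sum_k \sum_i \sum_j a k i * a k j *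
        ((natdist i j).+1%:R / (n.+1 ^ 2)%:R) `^ (- s)) / lam <= K%:R / 2.
  rewrite ler_pdivrMr// /lam; apply: le_trans (ltW aE) _.
  by rewrite le_eqVlt; apply/orP; left; apply/eqP; field; rewrite gt_eqF.
lra.
Qed.

End covers.

(** * Lower bound: random masses near the zero set *)

Section lower_bound.
Context {R : realType} {d : measure_display} {T : measurableType d}.
Variables (P : probability T R) (B : R -> T -> R) (f : R -> R) (C : R).
Hypothesis hB : standard_brownian_motion P B.
Hypothesis C0 : 0 <= C.
Hypothesis fC : forall t, 0 < t <= 1 -> `|f t| <= C * Num.sqrt t.
Local Notation Pr := (Pr P).

(** The mesh of scale k is theta^(2 k) / (2 N); N is a square so that the window, of the order of
    the square root of the mesh, is explicit. *)
Definition scale_event (theta : R) (n k i : nat) : set T :=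
  near_event B (scale_time theta (n.+1 ^ 2) k i)
    (f (scale_time theta (n.+1 ^ 2) k i)) (theta ^+ k * n.+1%:R^-1).

Section fixed_scale.
Variables (theta : R) (n : nat).
Hypothesis th : 0 < theta <= 1 / 4.
Hypothesis nth : n.+1%:R^-1 <= theta.
Local Notation N := (n.+1 ^ 2)%N.
Local Notation tm k i := (scale_time theta N k i).

Let th0 : 0 < theta. Proof. by case/andP: th. Qed.
Let th01 : 0 < theta < 1. Proof. by move: th => /andP[? ?]; apply/andP; split; lra. Qed.
Let e0 : 0 < n.+1%:R^-1 :> R. Proof. by rewrite invr_gt0 ltr0n. Qed.
Let N0 : (0 < N)%N. Proof. by rewrite expn_gt0. Qed.

Let tm_gt0 k (i : 'I_N) : 0 < tm k i.
Proof.
have /andP[h _] := scale_time_itv k (ltn_ord i) th01.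
by apply: lt_le_trans h; rewrite divr_gt0// exprn_gt0.
Qed.

Let tm_le1 k (i : 'I_N) : tm k i <= 1.
Proof.
have /andP[_ h] := scale_time_itv k (ltn_ord i) th01.
by apply: le_trans h _; apply: exprn_ile1; move: th => /andP[? ?]; lra.
Qed.

Let sqrt_tm_le k (i : 'I_N) : Num.sqrt (tm k i) <= theta ^+ k.
Proof.
have /andP[_ h] := scale_time_itv k (ltn_ord i) th01.
apply: le_trans (ler_wsqrtr h) _.
by rewrite mulnC exprM sqrtr_sqr ger0_norm// exprn_ge0// ltW.
Qed.

Let sqrt_tm_ge k (i : 'I_N) : theta ^+ k / 2 <= Num.sqrt (tm k i).
Proof.
have /andP[h _] := scale_time_itv k (ltn_ord i) th01.
have t0 : 0 <= theta ^+ k / 2 by rewrite divr_ge0// exprn_ge0// ltW.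
rewrite -[leLHS]ger0_norm// -sqrtr_sqr; apply: ler_wsqrtr; apply: le_trans h.
rewrite exprMn -exprM mulnC; have : 0 < theta ^+ (2 * k) by rewrite exprn_gt0.
by lra.
Qed.

(** For 1 / (n + 1) <= theta the windows meet the smallness condition of [near_event2_far] with q =
    2 theta. *)
Let window_le k (i : 'I_N) : theta ^+ k * n.+1%:R^-1 <= 2 * theta * Num.sqrt (tm k i).
Proof.
have := sqrt_tm_ge k i => h.
have k0 : 0 <= theta ^+ k by rewrite exprn_ge0// ltW.
apply: (@le_trans _ _ (theta ^+ k * theta)); first by rewrite ler_wpM2l.
have := th0; nra.
Qed.

Let window_le1 k (i : 'I_N) : theta ^+ k * n.+1%:R^-1 <= Num.sqrt (tm k i).
Proof.
apply: le_trans (window_le k i) _; rewrite ler_piMl ?sqrtr_ge0//.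
by move: th => /andP[? ?]; lra.
Qed.

Let window_gt0 k : 0 < theta ^+ k * n.+1%:R^-1.
Proof. by rewrite mulr_gt0// exprn_gt0. Qed.

Let f_tm k (i : 'I_N) : `|f (tm k i)| <= C * Num.sqrt (tm k i).
Proof. by apply: fC; rewrite tm_gt0 tm_le1. Qed.

Lemma measurable_scale_event k (i : 'I_N) : measurable (scale_event theta n k i).
Proof. by apply: (measurable_near_event hB); exact: ltW. Qed.

Let scale_event_ge k (i : 'I_N) :
  near_const C * n.+1%:R^-1 <= Pr (scale_event theta n k i).
Proof.
apply: le_trans (near_event_ge_ratio hB (tm_gt0 k i) (ltW (window_gt0 k)) C0
  (f_tm k i) (window_le1 k i)).
rewrite ler_wpM2l ?(ltW (near_const_gt0 C))//.
rewrite ler_pdivlMr ?sqrtr_gt0// mulrC ler_wpM2r//; exact: ltW.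
Qed.

Let scale_event_gt0 k (i : 'I_N) : 0 < Pr (scale_event theta n k i).
Proof. by apply: lt_le_trans (scale_event_ge k i); rewrite mulr_gt0// near_const_gt0. Qed.

(** The larger index is the earlier time. The times have ratio at most 2 theta^2 and the windows at
    most theta, so q = 2 theta is admissible. *)
Let scale_event_lt k k' (i j : 'I_N) : (k' < k)%N ->
  Pr (scale_event theta n k i `&` scale_event theta n k' j) <=
  Pr (scale_event theta n k i) * Pr (scale_event theta n k' j) *
  expR ((C ^+ 2 + 3 * C + 4) * (2 * theta)).
Proof.
move=> kk; have /andP[_ th4] := th.
have /andP[_ hs] := scale_time_itv k (ltn_ord i) th01.
have /andP[ht _] := scale_time_itv k' (ltn_ord j) th01.
have sq : theta ^+ (2 * k) <= theta ^+ 2 * theta ^+ (2 * k').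
  rewrite -exprD; apply: ler_wiXn2l; [exact: ltW|lra|].
  by rewrite -[X in (X + _)%N]muln1 -mulnDr leq_mul2l add1n kk orbT.
have q0 : 0 < theta ^+ (2 * k') by rewrite exprn_gt0.
have st : tm k i <= (2 * theta) ^+ 2 * tm k' j.
  apply: le_trans hs _; apply: le_trans sq _; rewrite exprMn.
  have : theta ^+ 2 * (theta ^+ (2 * k') / 2) <= theta ^+ 2 * tm k' j.
    by rewrite ler_wpM2l// exprn_ge0// ltW.
  have : 0 <= theta ^+ 2 * tm k' j by rewrite mulr_ge0 ?exprn_ge0// ltW.
  lra.
have t0 := tm_gt0 k' j.
apply: (near_event2_far hB) => //.
- have : (2 * theta) ^+ 2 <= 1 / 4 by have := th0; nra.
  by move=> ?; nra.
- by apply/andP; split; [have := th0; lra|lra].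
- exact: ltW.
- exact: ltW.
- rewrite mulrA; apply: ler_wpM2r; first exact: ltW.
  apply: (@le_trans _ _ (theta ^+ k'.+1)).
    by apply: ler_wiXn2l => //; [exact: ltW|lra].
  by rewrite exprS ler_wpM2r ?exprn_ge0 ?(ltW th0)//; have := th0; lra.
Qed.

(** As d + 1 <= 2 d for d = |i - j| >= 1, the later time t satisfies t h <= 4 (t - s): sqrt (t / (t
    - s)) is at most 2 h^(-1/2). *)
Let scale_event_near k (i j : 'I_N) : (i < j)%N ->
  Pr (scale_event theta n k i `&` scale_event theta n k j) <=
  Pr (scale_event theta n k i) * Pr (scale_event theta n k j) *
  (4 / near_const C * ((natdist i j).+1%:R / N%:R) `^ (- (1 / 2))).
Proof.
move=> ij.
have N0' : 0 < N%:R :> R by rewrite ltr0n.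
have q0 : 0 < theta ^+ (2 * k) by rewrite exprn_gt0.
have tsE : tm k j - tm k i = theta ^+ (2 * k) / 2 * ((natdist i j)%:R / N%:R).
  rewrite /natdist (eqP (ltnW ij : (i - j == 0)%N)) add0n natrB ?(ltnW ij)//.
  by rewrite /scale_time; field; rewrite gt_eqF.
have dpos : 1 <= (natdist i j)%:R :> R.
  by rewrite ler1n /natdist addn_gt0 !subn_gt0 ij orbT.
have ts0 : 0 < tm k j - tm k i.
  by rewrite tsE mulr_gt0 ?divr_gt0//; lra.
have st : tm k i < tm k j by lra.
apply: le_trans (near_event2_close hB (f (tm k i)) (tm_gt0 k i) st C0 (f_tm k j)
  (window_gt0 k) (window_le1 k j)) _.
rewrite ler_wpM2l ?mulr_ge0 ?Pr_ge0//.
have h0 : 0 < (natdist i j).+1%:R / N%:R :> R by rewrite divr_gt0 ?ltr0n.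
have -> : 4 / near_const C = 2 / near_const C * 2.
  by rewrite mulrAC; congr (_ / _); ring.
rewrite -[leRHS]mulrA ler_wpM2l ?divr_ge0 ?(ltW (near_const_gt0 C))//.
rewrite powRN [1 / 2]mul1r powR12_sqrt ?(ltW h0)//.
rewrite ler_pdivrMr ?sqrtr_gt0// mulrAC ler_pdivlMr ?sqrtr_gt0//.
have -> : 2 * Num.sqrt (tm k j - tm k i) = Num.sqrt (2 ^+ 2 * (tm k j - tm k i)).
  by rewrite sqrtrM ?sqr_ge0// sqrtr_sqr ger0_norm.
rewrite -sqrtrM ?(ltW (tm_gt0 _ _))//; apply: ler_wsqrtr.
have /andP[_ ht] := scale_time_itv k (ltn_ord j) th01.
apply: (@le_trans _ _ (theta ^+ (2 * k) * ((natdist i j).+1%:R / N%:R))).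
  by rewrite ler_wpM2r// ltW.
rewrite tsE -natr1.
have -> : 2 ^+ 2 * (theta ^+ (2 * k) / 2 * ((natdist i j)%:R / N%:R)) =
  theta ^+ (2 * k) * ((2 * (natdist i j)%:R) / N%:R) by field; rewrite gt_eqF.
rewrite ler_wpM2l ?(ltW q0)// ler_wpM2r ?invr_ge0//; lra.
Qed.

Lemma scale_mass_energy (K : nat) (kappa s L : R) : (0 < K)%N ->
  expR ((C ^+ 2 + 3 * C + 4) * (2 * theta)) <= 1 + kappa -> 0 <= kappa ->
  0 <= s < 1 / 2 -> 0 < L ->
  exists G : set T, [/\ measurable G,
    (P G <= (4 * kappa + 32 * (4 / near_const C) / K%:R +
       K%:R * (4 / near_const C * (4 / (1 / 2 - s))) / L)%:E)%E &
    forall w, ~ G w ->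
      K%:R / 2 < hit_mass P (fun (k : 'I_K) (i : 'I_N) => scale_event theta n k i) w /\
      hit_energy P (fun (k : 'I_K) (i : 'I_N) => scale_event theta n k i) s w < L].
Proof.
move=> K0 hk kappa0 hs L0.
have c0 := near_const_gt0 C.
apply: hit_mass_energy => //.
- by rewrite divr_ge0// ltW.
- by move=> k i; exact: measurable_scale_event.
- move=> k k' i j kk.
  have pp : 0 <= Pr (scale_event theta n k i) * Pr (scale_event theta n k' j).
    by rewrite mulr_ge0 ?Pr_ge0.
  apply: le_trans (ler_wpM2l pp hk).
  case: (ltngtP k k') => [lt|lt|eq]; last by move: kk; rewrite eq_sym -(inj_eq val_inj)/= eq eqxx.
  + by rewrite setIC [X in X * _]mulrC; exact: scale_event_lt.
  + exact: scale_event_lt.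
- move=> k i j; case: (ltngtP i j) => [lt|lt|eq].
  + exact: scale_event_near.
  + by rewrite setIC [X in X * _]mulrC natdistC; exact: scale_event_near.
  (* On the diagonal the ratio is 1 / P(A), of order n + 1, and the kernel is exactly N^(1/2) = n +
     1: a window much smaller than the root of the mesh would fail here. *)
  + have -> : i = j by apply: val_inj.
    rewrite setIid -mulrA ler_peMr ?Pr_ge0//.
    rewrite /natdist subnn addn0.
    have -> : (1%:R / N%:R : R) `^ (- (1 / 2)) = n.+1%:R.
      rewrite powRN [1 / 2]mul1r powR12_sqrt ?divr_ge0// natrX -[1%:R](expr1n _ 2).
      by rewrite -expr_div_n sqrtr_sqr ger0_norm ?divr_ge0// invf_div divr1.
    have z0 : 0 <= 4 / near_const C * n.+1%:R by rewrite mulr_ge0// divr_ge0// ltW.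
    apply: le_trans (ler_wpM2r z0 (scale_event_ge k j)).
    have -> : near_const C / n.+1%:R * (4 / near_const C * n.+1%:R) = 4.
      by field; rewrite !gt_eqF// addr_gt0.
    by lra.
Qed.

End fixed_scale.

Lemma lower_negligible (s : R) : 0 < s < 1 / 2 ->
  P.-negligible [set w | continuous_on01 (fun t => recentre B t w - f t) /\
    hausdorff_measure s (zeros `[0, 1] (fun t => recentre B t w - f t)) = 0%E].
Proof.
move=> /andP[s0 s2]; apply: negligible_liminf => eta eta0.
have c0 := near_const_gt0 C.
pose C1 : R := 4 / near_const C.
have C10 : 0 < C1 by rewrite divr_gt0.
(* [K], [kappa] and [L] each keep one of the three error terms below eta / 3; [theta] depends on
   [kappa], and [L] on [K]. *)
pose K := (Num.trunc (32 * C1 * 3 / eta)).+1.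
have K0 : (0 < K)%N by [].
have K0' : 0 < K%:R :> R by rewrite ltr0n.
have hK : 32 * C1 / K%:R <= eta / 3.
  have := truncnS_gt (32 * C1 * 3 / eta); rewrite -/K ltr_pdivrMr// ler_pdivrMr//.
  by move=> h; nra.
pose kappa : R := eta / 12.
have kappa0 : 0 < kappa by rewrite divr_gt0.
pose D : R := C ^+ 2 + 3 * C + 4.
have D0 : 0 < D by rewrite /D; have := sqr_ge0 C; have := C0; lra.
(* 1/4 gives q = 2 theta <= 1/2; the logarithm gives exp (D q) <= 1 + kappa. *)
pose theta : R := Num.min (1 / 4) (ln (1 + kappa) / (2 * D)).
have k1 : 1 < 1 + kappa by rewrite ltrDl.
have th0 : 0 < theta.
  by rewrite /theta lt_min; apply/andP; split; [lra|rewrite divr_gt0 ?ln_gt0// mulr_gt0].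
have th4 : theta <= 1 / 4 by rewrite /theta ge_min lexx.
have hk : expR (D * (2 * theta)) <= 1 + kappa.
  rewrite -[leRHS]lnK ?posrE; last by lra.
  rewrite ler_expR mulrCA mulrA -ler_pdivlMl ?mulr_gt0// mulrC.
  by rewrite /theta ge_min lexx orbT.
pose X : R := K%:R * (C1 * (4 / (1 / 2 - s))).
have X0 : 0 < X by rewrite !mulr_gt0// invr_gt0; lra.
pose L := X * 3 / eta.
have L0 : 0 < L by rewrite divr_gt0// mulr_gt0.
have hL : X / L <= eta / 3.
  by rewrite /L le_eqVlt; apply/orP; left; apply/eqP; field; rewrite !gt_eqF.
pose n0 := Num.trunc theta^-1.
have nth n : (n0 <= n)%N -> n.+1%:R^-1 <= theta.
  move=> nn; rewrite invf_ple ?posrE ?ltr0n// ltW//.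
  by apply: lt_le_trans (truncnS_gt _) _; rewrite ler_nat ltnS.
have th : 0 < theta <= 1 / 4 by rewrite th0.
have hs : 0 <= s < 1 / 2 by rewrite ltW.
have th1 : 0 < theta < 1 by apply/andP; split => //; lra.
pose hm n w := hit_mass P (fun (k : 'I_K) (i : 'I_(n.+1 ^ 2)) => scale_event theta n k i) w.
pose he n w := hit_energy P (fun (k : 'I_K) (i : 'I_(n.+1 ^ 2)) => scale_event theta n k i) s w.
have [G HG] : {G : nat -> set T & forall n, measurable (G n) /\ ((n0 <= n)%N ->
    (P (G n) <= eta%:E)%E /\ forall w, ~ G n w -> K%:R / 2 < hm n w /\ he n w < L)}.
  apply: (@choice _ _ (fun n G => measurable G /\ ((n0 <= n)%N ->
    (P G <= eta%:E)%E /\ forall w, ~ G w -> K%:R / 2 < hm n w /\ he n w < L))) => n.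
  case: (leqP n0 n) => nn; last by exists set0; split.
  have [G [mG PG HG]] := scale_mass_energy th (nth n nn) K0 hk (ltW kappa0) hs L0.
  exists G; split=> // _; split=> //.
  apply: le_trans PG _; rewrite lee_fin -/C1 -/X.
  rewrite /kappa; lra.
exists G; split.
- by move=> n; case: (HG n).
- by exists n0 => n nn; case: (HG n) => _ /(_ nn)[].
(* A path that is not eventually in all [G n] has controlled mass and energy at arbitrarily large
   n. *)
- move=> w [cg H0]; apply: contrapT => nG; apply: (hausdorff_measure_neq0 cg K0 th1 s0 L0) H0 => m0.
  apply: contrapT => nn; apply: nG; exists (maxn m0 n0) => n.
  rewrite geq_max => /andP[m0n n0n]; apply: contrapT => nGn; apply: nn.
  have [_ /(_ n0n)[_ /(_ w nGn)[M E]]] := HG n.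
  exists n; split=> //.
  pose A := fun (k : 'I_K) (i : 'I_(n.+1 ^ 2)) => scale_event theta n k i.
  exists (fun k i => hit_weight P A k i * \1_(A k i) w); split.
  + by move=> k i; rewrite mulr_ge0// invr_ge0 mulr_ge0 ?Pr_ge0.
  + move=> k i; rewrite mulf_eq0 negb_or indicE => /andP[_].
    rewrite pnatr_eq0 eqb0 negbK inE => /le_trans; apply.
    rewrite ler_piMl// exprn_ile1//; lra.
  + exact: M.
  + apply: le_lt_trans E; rewrite /he /hit_energy le_eqVlt; apply/orP; left; apply/eqP.
    apply: eq_bigr => k _; apply: eq_bigr => i _; apply: eq_bigr => j _.
    by rewrite indicI/=; ring.
Qed.

End lower_bound.

(** * Dyadic chaining and dyadic coverings *)

Section chaining.
Context {R : realType}.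
Implicit Types (b c t : R) (g : R -> R).

Lemma expr_archi b (x : R) : 1 < b -> exists m, x <= b ^+ m.
Proof.
move=> b1.
have B m : 1 + m%:R * (b - 1) <= b ^+ m.
  elim: m => [|m IH]; first by rewrite mul0r addr0 expr0.
  rewrite exprS -natr1.
  have m0 : 0 <= m%:R :> R by [].
  have : b * (1 + m%:R * (b - 1)) <= b * b ^+ m by rewrite ler_wpM2l//; lra.
  by apply: le_trans; have := mulr_ge0 m0 (sqr_ge0 (b - 1)); lra.
exists (Num.trunc (x / (b - 1))).+1; apply: le_trans (B _).
have b0 : 0 < b - 1 by lra.
have := truncnS_gt (x / (b - 1)); rewrite ltr_pdivrMr// => h.
by apply: ltW; apply: lt_le_trans h _; rewrite lerDr.
Qed.

Lemma expr_small b (x : R) : 0 < b < 1 -> 0 < x ->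
  exists m0, forall m, (m0 <= m)%N -> b ^+ m <= x.
Proof.
move=> /andP[b0 b1] x0.
have [|m0 Hm0] := @expr_archi b^-1 x^-1; first by rewrite invf_gt1.
exists m0 => m mm; apply: (@le_trans _ _ (b ^+ m0)).
  by apply: ler_wiXn2l => //; exact: ltW.
by rewrite -[leLHS]invrK -exprVn invf_ple ?posrE// exprn_gt0// invr_gt0.
Qed.

Definition dyadic (n k : nat) : R := k%:R / 2 ^+ n.

Lemma dyadic_refine n m k : dyadic (n + m) (k * 2 ^ m) = dyadic n k.
Proof.
rewrite /dyadic natrM natrX exprD; field.
by rewrite !expf_neq0.
Qed.

Lemma dyadic_chaining_point g b n k : 0 < b < 1 -> (k < 2 ^ n)%N ->
  (forall j i, (n <= j)%N -> (i < 2 ^ j)%N ->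
    `|g (dyadic j i.+1) - g (dyadic j i)| <= b ^+ j) ->
  forall m i, (i <= 2 ^ m)%N ->
  `|g (dyadic (n + m) (k * 2 ^ m + i)) - g (dyadic n k)| <=
    (b ^+ n - b ^+ (n + m.+1)) / (1 - b).
Proof.
move=> /andP[b0 b1] kn H.
have b1' : 0 < 1 - b by lra.
have U0 m : 0 <= (b ^+ n - b ^+ (n + m.+1)) / (1 - b).
  rewrite divr_ge0 ?(ltW b1')// subr_ge0; apply: ler_wiXn2l; rewrite ?(ltW b0) ?(ltW b1)//.
  exact: leq_addr.
have US m : (b ^+ n - b ^+ (n + m.+2)) / (1 - b) =
    (b ^+ n - b ^+ (n + m.+1)) / (1 - b) + b ^+ (n + m.+1).
  by rewrite addnS exprS; field; rewrite gt_eqF.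
elim=> [|m IH] i im.
  rewrite expn0 muln1 addn0; case: i im => [|[|i]] // _.
    by rewrite addn0 subrr normr0.
  rewrite addn1; apply: le_trans (H n k (leqnn _) kn) _.
  by rewrite addn1 exprS ler_pdivlMr//; lra.
have even i' : (i' <= 2 ^ m)%N ->
    dyadic (n + m.+1) (k * 2 ^ m.+1 + i'.*2) = dyadic (n + m) (k * 2 ^ m + i').
  move=> _; rewrite -(dyadic_refine (n + m) 1) addn1 addnS expn1 mulnDl.
  by rewrite expnSr mulnA !muln2.
rewrite -(odd_double_half i) in im *.
have im2 : (i./2 <= 2 ^ m)%N.
  have : (i./2.*2 <= 2 ^ m.+1)%N by apply: leq_trans im; exact: leq_addl.
  by rewrite expnS mul2n leq_double.
case: (odd i) im => /= im.
  rewrite [(1 + _)%N]add1n [(k * 2 ^ m.+1 + _)%N]addnS.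
  have lt : (k * 2 ^ m.+1 + i./2.*2 < 2 ^ (n + m.+1))%N.
    have : (k * 2 ^ m.+1 + i./2.*2 < k * 2 ^ m.+1 + 2 ^ m.+1)%N by rewrite ltn_add2l.
    by move=> /leq_trans; apply; rewrite expnD addnC -mulSn leq_mul2r kn orbT.
  have h1 := H (n + m.+1)%N _ (leq_addr _ _) lt.
  have h2 := IH _ im2; rewrite -even// in h2.
  rewrite US.
  set x := g (dyadic _ _.+1); set y := g (dyadic (n + m.+1) (k * 2 ^ m.+1 + i./2.*2)) in h1 h2.
  have -> : x - g (dyadic n k) = (y - g (dyadic n k)) + (x - y) by ring.
  by apply: le_trans (ler_normD _ _) _; exact: lerD.
rewrite add0n even//; apply: le_trans (IH _ im2) _.
by rewrite US lerDl exprn_ge0// ltW.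
Qed.

(** Approximate t from the left by dyadic points and use continuity. The last step, to the right
    endpoint, is there because that endpoint is positive even when k = 0. *)
Lemma dyadic_chaining g b n k t : 0 < b < 1 -> (k < 2 ^ n)%N ->
  continuous_on01 g ->
  (forall j i, (n <= j)%N -> (i < 2 ^ j)%N ->
    `|g (dyadic j i.+1) - g (dyadic j i)| <= b ^+ j) ->
  dyadic n k < t <= dyadic n k.+1 ->
  `|g t - g (dyadic n k.+1)| <= (1 + (1 - b)^-1) * b ^+ n.
Proof.
move=> hb kn cg H /andP[kt tk]; have /andP[b0 b1] := hb.
have b1' : 0 < 1 - b by lra.
have p0 j : 0 < 2 ^+ j :> R by rewrite exprn_gt0.
have t0 : 0 < t by apply: le_lt_trans kt; rewrite divr_ge0// ltW.
have t1 : t <= 1.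
  by apply: le_trans tk _; rewrite /dyadic ler_pdivrMr// mul1r -natrX ler_nat.
have t01 : 0 < t <= 1 by rewrite t0.
have left : `|g t - g (dyadic n k)| <= (1 - b)^-1 * b ^+ n.
  apply/ler_addgt0Pr => e e0.
  have [dl dl0 Hdl] := cg t e t01 e0.
  (* A mesh below t as well as [dl] keeps the approximating point positive, where continuity is
     available. *)
  have x0 : 0 < Num.min dl t / 2 by rewrite divr_gt0// lt_min dl0.
  have [|m Hm] := @expr_small 2^-1 (Num.min dl t / 2) _ x0; first by apply/andP; split; lra.
  have hx := Hm (n + m)%N (leq_addl _ _).
  pose z := (t - dyadic n k) * 2 ^+ (n + m).
  have z0 : 0 <= z by rewrite mulr_ge0// ?subr_ge0 ltW.
  have /andP[z1 z2] := truncn_itv z0.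
  set i := Num.trunc z in z1 z2.
  have im : (i <= 2 ^ m)%N.
    rewrite -(ler_nat R); apply: le_trans z1 _.
    have : t - dyadic n k <= (2 ^+ n)^-1.
      apply: le_trans (lerB tk (lexx _)) _.
      by rewrite /dyadic -natr1 le_eqVlt; apply/orP; left; apply/eqP; ring.
    rewrite /z exprD mulrA natrX => h; rewrite ler_piMl ?(ltW (p0 m))//.
    by rewrite -ler_pdivlMr// mul1r.
  have h1 := dyadic_chaining_point hb kn H im.
  set u := dyadic (n + m) _ in h1.
  have uE : u = dyadic n k + i%:R / 2 ^+ (n + m).
    by rewrite /u -[dyadic n k](dyadic_refine n m) /dyadic natrD mulrDl.
  have ut : 0 <= t - u < Num.min dl t.
    have -> : t - u = (z - i%:R) / 2 ^+ (n + m).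
      by rewrite uE /z; field; rewrite gt_eqF.
    rewrite divr_ge0 ?subr_ge0 ?(ltW (p0 _))//=.
    rewrite exprVn in hx.
    apply: (@le_lt_trans _ _ (1 / 2 ^+ (n + m))).
      rewrite ler_wpM2r ?invr_ge0 ?(ltW (p0 _))//.
      by move: z2; rewrite -natr1; lra.
    rewrite div1r; apply: le_lt_trans hx _.
    have := x0; lra.
  move: ut => /andP[ut0]; rewrite lt_min => /andP[ut1 ut2].
  have u01 : 0 < u <= 1 by apply/andP; split; lra.
  have h2 : `|g u - g t| < e.
    by apply: Hdl => //; rewrite distrC ger0_norm.
  have -> : g t - g (dyadic n k) = (g u - g (dyadic n k)) - (g u - g t) by ring.
  apply: le_trans (ler_normB _ _) _; apply: lerD; last exact: ltW.
  apply: le_trans h1 _; rewrite mulrC ler_wpM2l ?invr_ge0 ?(ltW b1')//.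
  by rewrite gerBl exprn_ge0// ltW.
have -> : g t - g (dyadic n k.+1) =
  (g t - g (dyadic n k)) - (g (dyadic n k.+1) - g (dyadic n k)) by ring.
apply: le_trans (ler_normB _ _) _; rewrite addrC mulrDl mul1r.
by apply: lerD => //; exact: H.
Qed.

(** Unselected cells are replaced by the empty set, of weight 0. The weight (2^(-n))^s is written as
    an n-th power for comparison with geometric sequences. *)
Lemma hausdorff_premeasure_dyadic (s delta : R) (A : set R) n (S : pred nat) :
  0 < s -> 2^-1 ^+ n <= delta ->
  (forall t, A t -> exists2 k, (k < 2 ^ n)%N && S k & dyadic n k < t <= dyadic n k.+1) ->
  (hausdorff_premeasure s delta A <=
    (\sum_(k < 2 ^ n) (2^-1 `^ s) ^+ n * (S k)%:R)%:E)%E.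
Proof.
move=> s0 hd cov.
pose E k : set R := if (k < 2 ^ n)%N && S k then
  [set t | dyadic n k < t <= dyadic n k.+1] else set0.
have h0 : 0 <= 2^-1 ^+ n :> R by rewrite exprn_ge0.
have dE k : (diam (E k) <= (2^-1 ^+ n)%:E)%E.
  apply: ge_ereal_sup => _ [x Ex [y Ey <-]]; rewrite lee_fin.
  move: Ex Ey; rewrite /E; case: ifP => // _ /= /andP[x1 x2] /andP[y1 y2].
  have e : dyadic n k.+1 = dyadic n k + 2^-1 ^+ n.
    by rewrite /dyadic -natr1 mulrDl mul1r exprVn.
  by rewrite ler_norml; apply/andP; split; lra.
have pE k : (diam_pow s (E k) <= ((2^-1 `^ s) ^+ n * ((k < 2 ^ n)%N && S k)%:R)%:E)%E.
  rewrite /diam_pow; case: ifP => [_|/negbT/set0P[x Ex]].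
    by rewrite lee_fin mulr_ge0// exprn_ge0// powR_ge0.
  move: (Ex); rewrite {1}/E; case: ifP => // _ _; rewrite mulr1.
  have d0 : (0 <= diam (E k))%E.
    by apply: ereal_sup_ubound; exists x => //; exists x => //; rewrite subrr normr0.
  have -> : ((2^-1 `^ s) ^+ n)%:E = ((2^-1 ^+ n)%:E `^ s)%E :> \bar R.
    have h2 : 0 <= 2^-1 :> R by rewrite invr_ge0.
    rewrite poweR_EFin -(powR_mulrn n (powR_ge0 _ _)) -(powR_mulrn n h2).
    by rewrite powRAC.
  by apply: gt0_ler_poweR; rewrite ?(ltW s0)// in_itv/= ?d0 ?leey ?lee_fin ?h0.
apply: (@le_trans _ _ (\sum_(0 <= i <oo) diam_pow s (E i))%E).
  apply: ereal_inf_lbound; exists E => //; split.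
    move=> t /cov[k kS kt]; exists k => //; by rewrite /E kS.
  by move=> k; apply: le_trans (dE k) _; rewrite lee_fin.
apply: lime_le; first by apply: is_cvg_nneseries => *; exact: diam_pow_ge0.
near=> m.
have nm : (2 ^ n <= m)%N by near: m; exact: nbhs_infty_ge.
rewrite (@big_cat_nat _ _ _ (2 ^ n))//= [X in (_ + X)%E]big1_seq ?adde0; last first.
  move=> k /andP[_]; rewrite mem_index_iota => /andP[nk _].
  by rewrite /diam_pow /E ltnNge nk/= eqxx.
rewrite big_mkord -sumEFin; apply: lee_sum => k _.
by apply: le_trans (pE k) _; rewrite ltn_ord.
Unshelve. all: by end_near.
Qed.

Lemma hausdorff_premeasure_ge0 (s delta : R) (A : set R) :
  (0 <= hausdorff_premeasure s delta A)%E.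
Proof.
apply: le_ereal_inf_tmp => _ [E _ <-]; apply: nneseries_ge0 => *; exact: diam_pow_ge0.
Qed.

Lemma hausdorff_measure_eq0 (s : R) (A : set R) :
  (forall delta e : R, 0 < delta -> 0 < e ->
    (hausdorff_premeasure s delta A <= e%:E)%E) ->
  hausdorff_measure s A = 0%E.
Proof.
move=> H.
have H0 delta : 0 < delta -> hausdorff_premeasure s delta A = 0%E.
  move=> d0; apply/eqP; rewrite eq_le hausdorff_premeasure_ge0 andbT.
  by apply/lee_addgt0Pr => e e0; rewrite add0e H.
apply/eqP; rewrite eq_le; apply/andP; split.
  by apply: ge_ereal_sup => _ [delta /= d0 <-]; rewrite H0.
by apply: ereal_sup_ubound; exists 1 => //=; exact: H0.
Qed.

End chaining.

(** * Upper bound: counting the dyadic cells that meet the zero set *)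

Section upper_bound.
Context {R : realType} {d : measure_display} {T : measurableType d}.
Variables (P : probability T R) (B : R -> T -> R) (f : R -> R) (C : R).
Hypothesis hB : standard_brownian_motion P B.
Hypothesis C0 : 0 <= C.
Hypothesis fC : forall s t, 0 <= s <= 1 -> 0 <= t <= 1 ->
  `|f s - f t| <= C * Num.sqrt `|s - t|.
Local Notation Pr := (Pr P).
Local Notation dyadic := (@dyadic R).

Lemma dyadic_ge0 n k : 0 <= dyadic n k.
Proof. by rewrite divr_ge0// exprn_ge0. Qed.

Lemma dyadic_step n k : dyadic n k.+1 - dyadic n k = (2 ^+ n)^-1.
Proof. by rewrite /dyadic -natr1; ring. Qed.

Lemma dyadic_cell n (t : R) : 0 < t -> t <= 1 ->
  exists k, [/\ (k < 2 ^ n)%N, dyadic n k < t & t <= dyadic n k.+1].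
Proof.
move=> t0 t1.
have p0 : 0 < 2 ^+ n :> R by rewrite exprn_gt0.
have ex : exists k, t <= dyadic n k.+1.
  exists (2 ^ n)%N; apply: le_trans t1 _.
  by rewrite /dyadic ler_pdivlMr// mul1r -natrX ler_nat.
case: (ex_minnP ex) => k tk kmin; exists k; split=> //.
- have : (k <= (2 ^ n).-1)%N.
    apply: kmin; rewrite prednK ?expn_gt0// /dyadic natrX divff ?gt_eqF//.
  by rewrite -ltnS prednK ?expn_gt0.
- case: k tk kmin => [|k] tk kmin; first by rewrite /dyadic mul0r.
  by rewrite ltNge; apply/negP => /kmin; rewrite ltnn.
Qed.

(** With q^m >= 4 and u = q^j / 4, exp u >= u^(m + 1) / (m + 1)! is at least a constant times 4^j,
    which beats the factor 2^j. *)
Lemma expR_geometric_le (q : R) : 1 < q -> exists2 A, 0 <= A &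
  forall j, 2 ^+ j * (2 * expR (- (q ^+ j / 4))) <= A / 2 ^+ j.+1.
Proof.
move=> q1; have [m Hm] := @expr_archi R q 4 q1.
have q0 : 0 <= q by lra.
have Hm1 : 4 <= q ^+ m.+1.
  by apply: le_trans Hm _; apply: ler_weXn2l => //; exact: ltW.
exists (4 * (m.+1`!%:R * 4 ^+ m.+1)); first by rewrite !mulr_ge0// exprn_ge0.
move=> j; set u := q ^+ j / 4.
have u0 : 0 <= u by rewrite divr_ge0// exprn_ge0.
have fa0 : 0 < m.+1`!%:R :> R by rewrite ltr0n fact_gt0.
have p4 k : 0 < 4 ^+ k :> R by rewrite exprn_gt0.
have p2 k : 0 < 2 ^+ k :> R by rewrite exprn_gt0.
have h1 : 4 ^+ j / 4 ^+ m.+1 <= u ^+ m.+1.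
  rewrite /u expr_div_n ler_pM2r ?invr_gt0// -exprM mulnC exprM.
  by apply: lerXn2r; rewrite ?nnegrE ?exprn_ge0.
have h2 : u ^+ m.+1 / m.+1`!%:R <= expR u.
  by apply: le_trans (expR_ge1Dxn m u0); rewrite lerDr.
have h3 : 4 ^+ j / 4 ^+ m.+1 / m.+1`!%:R <= expR u.
  by apply: le_trans h2; rewrite ler_pM2r ?invr_gt0.
have h4 : expR (- u) <= m.+1`!%:R * 4 ^+ m.+1 / 4 ^+ j.
  rewrite expRN -[leLHS]mul1r ler_pdivrMr ?expR_gt0//.
  have z0 : 0 <= m.+1`!%:R * 4 ^+ m.+1 / 4 ^+ j :> R.
    by rewrite divr_ge0 ?(ltW (p4 _))// mulr_ge0// ltW.
  apply: le_trans (ler_wpM2l z0 h3).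
  rewrite le_eqVlt; apply/orP; left; apply/eqP; field.
  by rewrite !gt_eqF.
apply: (@le_trans _ _ (2 ^+ j * (2 * (m.+1`!%:R * 4 ^+ m.+1 / 4 ^+ j)))).
  by rewrite ler_wpM2l ?(ltW (p2 j))// ler_wpM2l.
have -> : 4 ^+ j = 2 ^+ j * 2 ^+ j :> R.
  by rewrite -exprMn; congr (_ ^+ _); ring.
rewrite [2 ^+ j.+1]exprS le_eqVlt; apply/orP; left; apply/eqP.
set M := m.+1`!%:R * _; field.
by rewrite !gt_eqF.
Qed.

Definition large_increment (b : R) (j i : nat) : set T :=
  [set w | b ^+ j < `|B (dyadic j i.+1) w - B (dyadic j i) w|].

(** The union of the events, written as a level set to suit [markov_simple]. *)
Definition some_large_increment (b : R) (j : nat) : set T :=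
  [set w | 1 <= \sum_(i < 2 ^ j) 1 * \1_(large_increment b j i) w :> R].

Let measurable_large_increment b j i : measurable (large_increment b j i).
Proof. by apply: (measurable_increment_gt hB); exact: dyadic_ge0. Qed.

(** An increment over time 2^(-j) exceeds b^j with probability at most 2 exp (- (2 b^2)^j / 4); as 2
    b^2 > 1, this is summable against the 2^j increments of a level. *)
Lemma large_increments_finite (b : R) : 0 < b -> 1 < 2 * b ^+ 2 ->
  P (lim_sup_set (some_large_increment b)) = 0%E.
Proof.
move=> b0 hq.
have [A A0 HA] := expR_geometric_le hq.
apply: lim_sup_set_cvg0 => [j|].
  by apply: measurable_simple_ge => i; exact: measurable_large_increment.
have PF j : (P (some_large_increment b j) <= (A / 2 ^+ j.+1)%:E)%E.
  apply: (le_trans (@markov_simple _ _ _ P _ (fun _ : 'I_(2 ^ j) => 1)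
    (fun i => large_increment b j i) 1 _ _ _)) => //.
    by move=> w; apply: sumr_ge0 => i _; rewrite mul1r.
  rewrite divr1 lee_fin; apply: le_trans (HA j).
  apply: (@le_trans _ _ (\sum_(i < 2 ^ j) (2 * expR (- ((2 * b ^+ 2) ^+ j / 4))))).
    apply: ler_sum => i _; rewrite mul1r.
    have st : dyadic j i < dyadic j i.+1.
      by rewrite -subr_gt0 dyadic_step invr_gt0 exprn_gt0.
    apply: le_trans (increment_tail hB (dyadic_ge0 j i) st (exprn_ge0 j (ltW b0))) _.
    rewrite dyadic_step ler_wpM2l// ler_expR lerN2.
    rewrite exprMn -!exprM mulnC le_eqVlt; apply/orP; left; apply/eqP; field.
    by rewrite expf_neq0.
  by rewrite sumr_const card_ord -[X in X <= _]mulr_natl natrX.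
apply: (@le_lt_trans _ _ A%:E); last by rewrite ltry.
apply: lime_le; first by apply: is_cvg_nneseries => *; exact: measure_ge0.
apply: nearW => m; rewrite big_mkord.
apply: (@le_trans _ _ (\sum_(j < m) (A / 2 ^+ j.+1)%:E)%E).
  by apply: lee_sum => j _; exact: PF.
by rewrite sumEFin lee_fin sum_half_pow_le.
Qed.

Definition hit_event (Q b : R) (n k : nat) : set T :=
  near_event B (dyadic n k.+1) (f (dyadic n k.+1)) (Q * b ^+ n).

(** Cell k is hit with probability at most Q b^n / sqrt ((k + 1) / 2^n), and 4 = 2 / (1 - 1/2) is
    the constant of the Riemann sum of x^(-1/2). *)
Lemma hit_count_small (Q b c rho : R) n : 0 <= Q -> 0 < b -> 0 < c -> 0 < rho ->
  measurable [set w | rho ^+ n <= \sum_(k < 2 ^ n) c ^+ n * \1_(hit_event Q b n k) w] /\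
  (P [set w | (rho ^+ n <= \sum_(k < 2 ^ n) c ^+ n * \1_(hit_event Q b n k) w)%R] <=
    (4 * Q * (2 * b * c / rho) ^+ n)%:E)%E.
Proof.
move=> Q0 b0 c0 rho0.
have cn k : 0 < c ^+ k by rewrite exprn_gt0.
have bn k : 0 < b ^+ k by rewrite exprn_gt0.
have mE (k : 'I_(2 ^ n)) : measurable (hit_event Q b n k).
  by apply: (measurable_near_event hB); exact: dyadic_ge0.
split; first exact: measurable_simple_ge.
apply: (le_trans (@markov_simple _ _ _ P _ (fun=> c ^+ n) _ _ mE _ _)).
  by rewrite exprn_gt0.
  by move=> w; apply: sumr_ge0 => k _; rewrite mulr_ge0// ltW.
rewrite lee_fin expr_div_n mulrA ler_wpM2r ?invr_ge0 ?exprn_ge0 ?(ltW rho0)//.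
have N0 : (0 < 2 ^ n)%N by rewrite expn_gt0.
have h12 : 0 <= (1 / 2 : R) < 1 by apply/andP; split; lra.
have S := @power_mean_le R (1 / 2) _ N0 h12.
have e4 : 2 / (1 - 1 / 2) = 4 :> R by field.
rewrite e4 in S.
apply: (@le_trans _ _ (\sum_(k < 2 ^ n)
    (c ^+ n * (Q * b ^+ n)) * (k.+1%:R / (2 ^ n)%:R) `^ (- (1 / 2)))).
  apply: ler_sum => k _; rewrite -mulrA ler_wpM2l ?(ltW (cn n))//.
  have t0 : 0 < dyadic n k.+1 by rewrite divr_gt0 ?ltr0n// exprn_gt0.
  have r0 : 0 <= Q * b ^+ n by rewrite mulr_ge0// ltW.
  apply: le_trans (near_event_le hB _ t0 r0) _.
  by rewrite natrX powRN [1 / 2]mul1r powR12_sqrt// ltW.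
rewrite -mulr_sumr; apply: le_trans (ler_wpM2l _ S) _.
  by rewrite !mulr_ge0// ltW.
by rewrite natrX !exprMn le_eqVlt; apply/orP; left; apply/eqP; ring.
Qed.

Lemma upper_negligible (s : R) : 1 / 2 < s ->
  P.-negligible [set w | continuous_on01 (fun t => recentre B t w) /\
    hausdorff_measure s (zeros `[0, 1] (fun t => recentre B t w - f t)) <> 0%E].
Proof.
move=> s2; have s0 : 0 < s by lra.
pose c : R := 2^-1 `^ s.
have c0 : 0 < c by rewrite powR_gt0.
have hc : 2 * c ^+ 2 < 1.
  have : c < 2^-1 `^ 2^-1.
    rewrite /c -[X in X `^ s]lnK ?posrE// -[X in _ < X `^ _]lnK ?posrE//.
    rewrite /powR !gt_eqF ?expR_gt0// !expRK ltr_expR.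
    by rewrite ltr_nM2r ?ln_lt0//; lra.
  rewrite powR12_sqrt// => h.
  have : Num.sqrt 2^-1 ^+ 2 = 2^-1 :> R by rewrite sqr_sqrtr.
  have : 0 <= Num.sqrt 2^-1 :> R by rewrite sqrtr_ge0.
  by nra.
have [b [b0 b1 hb hbc]] : exists b : R, [/\ 0 < b, b < 1, 1 < 2 * b ^+ 2 & 2 * b * c < 1].
  (* [v] is b^2: above 1/2 for the control of increments, below 1 for chaining, and below 1 / (4
     c^2) for 2 b c < 1. The room is there because c^2 < 1/2. *)
  pose v : R := (1 / 2 + Num.min 1 (4 * c ^+ 2)^-1) / 2.
  have c2 : 0 < c ^+ 2 by rewrite exprn_gt0.
  have m1 : Num.min 1 (4 * c ^+ 2)^-1 <= 1 by rewrite ge_min lexx.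
  have m2 : Num.min 1 (4 * c ^+ 2)^-1 <= (4 * c ^+ 2)^-1 by rewrite ge_min lexx orbT.
  have m3 : 1 / 2 < Num.min 1 (4 * c ^+ 2)^-1.
    rewrite lt_min; apply/andP; split; first lra.
    by rewrite -[ltRHS]mul1r ltr_pdivlMr; lra.
  have v0 : 1 / 2 < v < 1 by rewrite /v; apply/andP; split; lra.
  have /andP[v1 v2] := v0.
  have b0 : 0 < Num.sqrt v by rewrite sqrtr_gt0; lra.
  have bv : Num.sqrt v ^+ 2 = v by rewrite sqr_sqrtr; lra.
  have v3 : v * (4 * c ^+ 2) < 1.
    rewrite -ltr_pdivlMr ?mulr_gt0// mul1r; apply: lt_le_trans m2; rewrite /v; lra.
  exists (Num.sqrt v); split; rewrite ?bv//.
  - by nra.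
  - by lra.
  - rewrite ltNge; apply/negP => h.
    have : 1 <= (2 * Num.sqrt v * c) ^+ 2 by apply: exprn_ege1.
    by rewrite !exprMn bv; lra.
have b01 : 0 < b < 1 by rewrite b0.
(* The chaining constant of [W] plus the Hoelder constant of [f]. *)
pose Q := 1 + (1 - b)^-1 + C.
have Q0 : 0 <= Q by rewrite !addr_ge0// invr_ge0; lra.
(* Midway between 2 b c and 1: the threshold rho^n and the Markov bound, a multiple of (2 b c /
   rho)^n, both tend to 0. *)
pose rho := (2 * b * c + 1) / 2.
have bc0 : 0 < 2 * b * c by rewrite !mulr_gt0.
have rho0 : 0 < rho by rewrite divr_gt0// addr_gt0.
have rho1 : rho < 1 by rewrite /rho; lra.
have rho01 : 0 < rho < 1 by rewrite rho0.
have x01 : 0 < 2 * b * c / rho < 1.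
  by rewrite divr_gt0//= ltr_pdivrMr// mul1r /rho; lra.
pose Bad w := continuous_on01 (fun t => recentre B t w) /\
    hausdorff_measure s (zeros `[0, 1] (fun t => recentre B t w - f t)) <> 0%E.
pose Z w := zeros `[0, 1] (fun t => recentre B t w - f t).
pose Reg w := exists J, forall j i, (J <= j)%N -> (i < 2 ^ j)%N ->
  `|recentre B (dyadic j i.+1) w - recentre B (dyadic j i) w| <= b ^+ j.
(* Paths with large increments at infinitely many levels are set aside as null; for the others
   chaining works from some level on. *)
apply: (@negligibleS _ _ _ P (lim_sup_set (some_large_increment b) `|`
    [set w | Bad w /\ Reg w])).
  move=> w Bw; case: (pselect (Reg w)) => [rw|nr]; [by right|left].
  move=> J _; apply: contrapT => nJ; apply: nr; exists J => j i Jj ij.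
  rewrite leNgt; apply/negP => lt; apply: nJ; exists j => //=.
  rewrite /some_large_increment/= (bigD1 (Ordinal ij))//= indicE mem_set; last first.
    rewrite /large_increment/=; move: lt; rewrite /recentre; congr (_ < `|_|); ring.
  by rewrite mulr1 lerDl sumr_ge0// => k _; rewrite mul1r.
apply: negligibleU.
  apply/negligibleP; last exact: large_increments_finite.
  apply: bigcap_measurable => // j _; apply: bigcup_measurable => k _.
  by apply: measurable_simple_ge => i; exact: measurable_large_increment.
apply: negligible_liminf => eta eta0.
exists (fun n => [set w | rho ^+ n <= \sum_(k < 2 ^ n) c ^+ n * \1_(hit_event Q b n k) w]).
have q1 : 0 < 4 * Q + 1 by have := Q0; lra.
split.
- by move=> n; have [] := hit_count_small n Q0 b0 c0 rho0.
- have [m0 Hm0] := expr_small x01 (divr_gt0 eta0 q1).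
  exists m0 => n /Hm0; rewrite ler_pdivlMr// => h.
  have [_ Pn] := hit_count_small n Q0 b0 c0 rho0.
  apply: le_trans Pn _; rewrite lee_fin; apply: le_trans h.
  rewrite mulrC ler_wpM2l ?lerDl// exprn_ge0// ltW//; by case/andP: x01.
(* A single fine level with weighted count below rho^n bounds the premeasure, so a path of nonzero
   measure has large counts at all levels from some point on. *)
- move=> w [[cw Hw] [J HJ]]; apply: contrapT => nev; apply: Hw.
  apply: hausdorff_measure_eq0 => delta e delta0 e0.
  have [m1 Hm1] := expr_small rho01 e0.
  have [|m2 Hm2] := @expr_small R 2^-1 delta _ delta0; first by apply/andP; split; lra.
  apply: contrapT => /negP; rewrite -ltNge => big.
  apply: nev; exists (maxn J (maxn m1 m2)) => n.
  rewrite !geq_max => /and3P[Jn m1n m2n] /=.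
  rewrite leNgt; apply/negP => small.
  move: big; apply/negP; rewrite -leNgt.
  pose S (k : nat) := `[< hit_event Q b n k w >].
  apply: le_trans (hausdorff_premeasure_dyadic (n := n) (S := S) s0 (Hm2 n m2n) _) _; last first.
    rewrite lee_fin; apply: le_trans (Hm1 n m1n); apply: le_trans (ltW small).
    apply: ler_sum => k _; rewrite indicE le_eqVlt; apply/orP; left; apply/eqP.
    by congr (_ * _%:R).
  move=> t [/= tI t0 gt]; move: tI; rewrite in_itv/= => /andP[_ t1].
  have [k [k2 kt tk]] := dyadic_cell n t0 t1.
  exists k => //; last by rewrite kt tk.
  rewrite k2/=; apply/asboolP; rewrite /hit_event /near_event/=.
  have kt' : dyadic n k < t <= dyadic n k.+1 by rewrite kt tk.
  have ch := dyadic_chaining b01 k2 cw (fun j i nj => HJ j i (leq_trans Jn nj)) kt'.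
  have k1 : dyadic n k.+1 <= 1.
    by rewrite /dyadic ler_pdivrMr ?exprn_gt0// mul1r -natrX ler_nat.
  (* A cell has length 2^(-n) <= b^(2 n), since b^2 > 1/2. *)
  have fh : `|f t - f (dyadic n k.+1)| <= C * b ^+ n.
    apply: le_trans (fC _ _) _; rewrite ?dyadic_ge0 ?(ltW t0) ?t1 ?k1//.
    have bE : b ^+ n = Num.sqrt ((b ^+ n) ^+ 2).
      by rewrite sqrtr_sqr ger0_norm// exprn_ge0// ltW.
    rewrite ler_wpM2l// bE.
    apply: ler_wsqrtr; apply: (@le_trans _ _ (2 ^+ n)^-1).
      by have := dyadic_step n k; rewrite distrC ger0_norm ?subr_ge0//; lra.
    rewrite -exprVn -exprM mulnC exprM; apply: lerXn2r; rewrite ?nnegrE ?sqr_ge0//.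
    by lra.
  have -> : recentre B (dyadic n k.+1) w - f (dyadic n k.+1) =
     (f t - f (dyadic n k.+1)) - (recentre B t w - recentre B (dyadic n k.+1) w).
    have -> : recentre B t w = f t by apply/eqP; rewrite -subr_eq0 gt.
    by ring.
  apply: le_trans (ler_normB _ _) _; rewrite /Q mulrDl addrC.
  exact: lerD.
Qed.

End upper_bound.

(** * From Hausdorff measures to the dimension, and the final assembly *)

Section hausdorff_dim_lemmas.
Context {R : realType}.
Implicit Types (s t : R) (A : set R).

Lemma diam_pow_exp_le s s' (E : set R) : 0 <= s -> s <= s' -> (diam E <= 1)%E ->
  (diam_pow s' E <= diam_pow s E)%E.
Proof.
move=> s0 ss' dE; rewrite /diam_pow; case: ifP => // /negbT/set0P[x Ex].
have d0 : (0 <= diam E)%E.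
  by apply: ereal_sup_ubound; exists x => //; exists x => //; rewrite subrr normr0.
case: (diam E) d0 dE => [r||]//; rewrite !lee_fin => r0 r1.
rewrite ?poweR_EFin ?lee_fin.
(* Diameter 0 is apart because 0 ^ 0 = 1: for s' > s the left side is 0 ^ s' = 0. *)
have [->|rn] := eqVneq r 0.
  have [->|s'n] := eqVneq s' s; first by [].
  rewrite (powR0 (x := s')); first exact: powR_ge0.
  by rewrite gt_eqF//; apply: le_lt_trans s0 _; rewrite lt_neqAle eq_sym s'n.
have -> : s' = s + (s' - s) by ring.
rewrite powRD; last by rewrite rn implybT.
rewrite ler_piMr ?powR_ge0//.
rewrite -[leRHS](_ : 1 `^ (s' - s) = 1); last by rewrite powR1.
by apply: ge0_ler_powR; rewrite ?nnegrE ?subr_ge0.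
Qed.

Lemma hausdorff_measure_eq0_le s s' A : 0 <= s -> s <= s' ->
  hausdorff_measure s A = 0%E -> hausdorff_measure s' A = 0%E.
Proof.
move=> s0 ss' H; apply: hausdorff_measure_eq0 => delta e delta0 e0.
(* Capped at 1, since r^s decreases in s only for r <= 1. *)
pose dl := Num.min delta 1.
have dl0 : 0 < dl by rewrite lt_min delta0 ltr01.
have : (hausdorff_premeasure s dl A < e%:E)%E.
  apply: (@le_lt_trans _ _ (hausdorff_measure s A)); last by rewrite H lte_fin.
  by apply: ereal_sup_ubound; exists dl.
move=> /ereal_inf_lt[_ [E [Ecov Ed] <-] Ee].
apply: le_trans (ltW Ee).
apply: (@le_trans _ _ (\sum_(0 <= i <oo) diam_pow s' (E i))%E).
  apply: ereal_inf_lbound; exists E => //; split=> // i.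
  by apply: le_trans (Ed i) _; rewrite lee_fin ge_min lexx.
apply: lee_nneseries => [i _ _|i _]; first exact: diam_pow_ge0.
apply: diam_pow_exp_le => //; apply: le_trans (Ed i) _.
by rewrite lee_fin ge_min lexx orbT.
Qed.

(** Countably many exponents are enough by monotonicity, so that a countable union of null sets
    remains; n + 3 keeps the lower exponents positive. *)
Lemma hausdorff_dim_half A :
  (forall n : nat, hausdorff_measure (1 / 2 + n.+1%:R^-1) A = 0%E) ->
  (forall n : nat, hausdorff_measure (1 / 2 - n.+3%:R^-1) A <> 0%E) ->
  hausdorff_dim A = (1 / 2)%:E.
Proof.
move=> up low.
have small (e : R) : 0 < e -> exists n : nat, n.+1%:R^-1 < e.
  by move=> e0; exists (Num.trunc e^-1); rewrite invf_plt ?posrE ?ltr0n ?truncnS_gt.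
apply/eqP; rewrite eq_le; apply/andP; split.
  apply/lee_addgt0Pr => e e0; have [n ne] := small e e0.
  apply: (@le_trans _ _ (1 / 2 + n.+1%:R^-1)%:E); last by rewrite -EFinD lee_fin lerD2l ltW.
  by apply: ereal_inf_lbound; exists (1 / 2 + n.+1%:R^-1).
apply: le_ereal_inf_tmp => _ [s [s0 Hs] <-]; rewrite lee_fin leNgt; apply/negP => s2.
have [n ne] := small (1 / 2 - s) (ltac:(by rewrite subr_gt0)).
apply: (low n); apply: hausdorff_measure_eq0_le Hs => //.
have : n.+3%:R^-1 <= n.+1%:R^-1 :> R.
  by rewrite lef_pV2 ?posrE ?ltr0n// ler_nat; exact: (leq_addl 2 n.+1).
by move: ne; move: (n.+3%:R^-1) (n.+1%:R^-1) => x y; lra.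
Qed.

Lemma continuous_on01_within (g : R -> R) :
  {within `[0, +oo[, continuous g} -> continuous_on01 g.
Proof.
move=> /subspace_continuousP cg t e /andP[t0 t1] e0.
have := cg t; rewrite /= in_itv/= (ltW t0) => /(_ isT).
move=> /cvgrPdist_lt /(_ e e0); rewrite near_withinE => /nbhs_ballP[dl /= dl0 H].
exists dl => // u /andP[u0 u1] ut; rewrite distrC; apply: H.
  by rewrite -ball_normE/= distrC.
by rewrite /= in_itv/= ltW.
Qed.

Lemma continuous_on01B (g f : R -> R) (C : R) : 0 <= C -> continuous_on01 g ->
  (forall s t, 0 <= s <= 1 -> 0 <= t <= 1 ->
    `|f s - f t| <= C * Num.sqrt `|s - t|) ->
  continuous_on01 (fun t => g t - f t).
Proof.
move=> C0 cg fC t e t01 e0.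
have e2 : 0 < e / 2 by rewrite divr_gt0.
have [dl dl0 H] := cg t _ t01 e2.
(* [C + 1] avoids dividing by zero, and times within x^2 change f by at most C x <= e / 2. *)
pose x := e / 2 / (C + 1).
have C1 : 0 < C + 1 by lra.
have x0 : 0 < x by rewrite divr_gt0.
exists (Num.min dl (x ^+ 2)); first by rewrite lt_min dl0 exprn_gt0.
move=> u u01; rewrite lt_min => /andP[u1 u2].
have h1 := H u u01 u1.
have h2 : `|f u - f t| <= C * x.
  have /andP[ua ub] := u01; have /andP[ta tb] := t01.
  apply: le_trans (fC _ _ _ _) _; rewrite ?ub ?tb ?andbT ?(ltW ua) ?(ltW ta)//.
  rewrite ler_wpM2l// -[leRHS]ger0_norm ?(ltW x0)// -(sqrtr_sqr x).
  by apply: ler_wsqrtr; exact: ltW.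
have h3 : C * x <= e / 2.
  rewrite /x mulrCA ler_piMr ?(ltW e2)// ler_pdivrMr//; lra.
have -> : g u - f u - (g t - f t) = (g u - g t) - (f u - f t) by ring.
have := ler_normB (g u - g t) (f u - f t); lra.
Qed.

End hausdorff_dim_lemmas.

Theorem corollary1p7 (R : realType) (d : measure_display) (T : measurableType d)
    (P : probability T R) (B : R -> T -> R) (f : R -> R)
    (hB : standard_brownian_motion P B)
    (hf : hoelder_continuous_on (1 / 2) `[0, 1] f)
    (hf0 : f 0 = 0) :
  {ae P, forall w,
    hausdorff_dim (zeros `[0, 1] (fun t => B t w - f t)) = (1 / 2)%:E}.
Proof.
have [C [C0 fC]] : exists C : R, 0 <= C /\ forall s t, 0 <= s <= 1 -> 0 <= t <= 1 ->
    `|f s - f t| <= C * Num.sqrt `|s - t|.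
  (* The definition of Hoelder continuity puts no sign on its constant, hence the absolute value. *)
  have [C HC] := hf; exists `|C|; split=> // s t s01 t01.
  have := HC s t; rewrite /= !in_itv/= s01 t01 => /(_ isT isT) /le_trans; apply.
  rewrite [1 / 2]mul1r powR12_sqrt// ler_wpM2r ?sqrtr_ge0//.
  exact: ler_norm.
have f1 t : 0 < t <= 1 -> `|f t| <= C * Num.sqrt t.
  move=> /andP[t0 t1]; have := fC t 0.
  rewrite hf0 !subr0 (ger0_norm (ltW t0)); apply; last by rewrite lexx ler01.
  by rewrite t1 ltW.
pose s_up (n : nat) : R := 1 / 2 + n.+1%:R^-1.
pose s_low (n : nat) : R := 1 / 2 - n.+3%:R^-1.
pose NU n := [set w | continuous_on01 (fun t => recentre B t w) /\
  hausdorff_measure (s_up n) (zeros `[0, 1] (fun t => recentre B t w - f t)) <> 0%E].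
pose NL n := [set w | continuous_on01 (fun t => recentre B t w - f t) /\
  hausdorff_measure (s_low n) (zeros `[0, 1] (fun t => recentre B t w - f t)) = 0%E].
have nU n : P.-negligible (NU n).
  by apply: (upper_negligible hB C0 fC); rewrite ltrDl invr_gt0 ltr0n.
have nL n : P.-negligible (NL n).
  apply: (lower_negligible hB C0 f1); rewrite /s_low.
  have h3 : n.+3%:R^-1 <= 3^-1 :> R by rewrite lef_pV2 ?posrE ?ltr0n// ler_nat.
  have h0 : 0 < n.+3%:R^-1 :> R by rewrite invr_gt0 ltr0n.
  by move: (n.+3%:R^-1) h3 h0 => x h3 h0; apply/andP; split; lra.
have n0 : P.-negligible (~` [set w | B 0 w = 0]) := bm_start hB.
have nc : P.-negligible (~` [set w | {within `[0, +oo[, continuous (fun t => B t w)}]) :=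
  bm_continuous hB.
rewrite /almost_everywhere.
apply: (@negligibleS _ _ _ P ((~` [set w | B 0 w = 0] `|`
    ~` [set w | {within `[0, +oo[, continuous (fun t => B t w)}]) `|`
    (\bigcup_n NU n `|` \bigcup_n NL n))); last first.
  apply: negligibleU; first exact: negligibleU.
  by apply: negligibleU; apply: negligible_bigcup.
move=> w nd; apply: contrapT => good; apply: nd => /=.
have [B0 cB] : B 0 w = 0 /\ {within `[0, +oo[, continuous (fun t => B t w)}.
  by split; apply: contrapT => h; apply: good; left; [left|right].
have rE : (fun t => recentre B t w) = (fun t => B t w).
  by apply/funext => t; rewrite /recentre B0 subr0.
have cr : continuous_on01 (fun t => recentre B t w).
  by rewrite rE; exact: continuous_on01_within.
have crf := continuous_on01B C0 cr fC.
have ZE : zeros `[0, 1] (fun t => B t w - f t) =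
    zeros `[0, 1] (fun t => recentre B t w - f t).
  by congr zeros; apply/funext => t; rewrite /recentre B0 subr0.
rewrite ZE; apply: hausdorff_dim_half => n.
  apply: contrapT => h; apply: good; right; left; exists n => //; by split.
by move=> h; apply: good; right; right; exists n.
Qed.
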